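(* Let $k$ be a field and let $s\ge 3$ be an integer. There exist a polynomial ring $R$ over $k$ and a squarefree monomial ideal $I\subset R$ such that, for positive integers $t$, $\operatorname{depth} R/I^{(s)} < \operatorname{depth} R/I^{(t)}$ if and only if $t\notin E(s)$, where $$E(s)=\bigcup_{i\ge 1}\{t\in\mathbb{N} \mid i(s-1)+1\le t\le is\}.$$
   Context: For a homogeneous ideal $I$ of a polynomial ring $R$ and $t\ge 0$, the $t$-th symbolic power $I^{(t)}$ is the intersection of the primary components of $I^t$ associated with the minimal primes of $I$. *)

(* Defs.v *)
From HB Require Import structures.
From mathcomp Require Import all_boot all_order all_algebra.
From mathcomp Require Import mpoly.
From Stdlib Require Import ClassicalEpsilon.

Set Implicit Arguments.
Unset Strict Implicit.
Unset Printing Implicit Defensive.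

Import GRing.Theory.
Local Open Scope ring_scope.

Section Defs.
Variables (k : fieldType) (n : nat).
Local Notation P := {mpoly k[n]}.

Definition ideal_of := P -> Prop.

Definition gen_ideal (S : ideal_of) : ideal_of := fun f =>
  exists l : seq (P * P),
    (forall p, p \in l -> S p.2) /\ f = \sum_(p <- l) p.1 * p.2.

Definition is_ideal (J : ideal_of) : Prop :=
  [/\ J 0, (forall a b, J a -> J b -> J (a + b)) & (forall r a, J a -> J (r * a))].

Definition is_prime (J : ideal_of) : Prop :=
  [/\ is_ideal J, ~ J 1 & (forall a b, J (a * b) -> J a \/ J b)].

Definition minimal_prime (I Q : ideal_of) : Prop :=
  [/\ is_prime Q, (forall f, I f -> Q f) &
      (forall Q', is_prime Q' -> (forall f, I f -> Q' f) ->
                  (forall f, Q' f -> Q f) -> forall f, Q f -> Q' f)].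

Definition ideal_pow (I : ideal_of) (t : nat) : ideal_of :=
  gen_ideal (fun f => exists l : seq P,
    [/\ size l = t, (forall g, g \in l -> I g) & f = \prod_(g <- l) g]).

(* symbolic power I^(t) = intersection over the minimal primes Q of I of the
   Q-primary component  I^t R_Q \cap R  of I^t *)
Definition sympow (I : ideal_of) (t : nat) : ideal_of := fun f =>
  forall Q, minimal_prime I Q -> exists g, ~ Q g /\ ideal_pow I t (g * f).

Definition max_homog : ideal_of := gen_ideal (fun g => exists i : 'I_n, g = 'X_i).

Definition ideal_add_seq (J : ideal_of) (fs : seq P) : ideal_of :=
  gen_ideal (fun g => J g \/ g \in fs).

Definition regular_seq (J : ideal_of) (fs : seq P) : Prop :=
  [/\ (forall f, f \in fs -> max_homog f),
      (forall i, (i < size fs)%N -> forall g,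
          ideal_add_seq J (take i fs) (nth 0 fs i * g) ->
          ideal_add_seq J (take i fs) g)
    & ~ ideal_add_seq J fs 1].

Definition has_regseq (J : ideal_of) (d : nat) : Prop :=
  exists fs, size fs = d /\ regular_seq J fs.

Definition asb (Q : Prop) : bool :=
  if excluded_middle_informative Q then true else false.

(* depth R/J = supremum of the lengths of R/J-regular sequences in m
   (0 if unbounded, which never happens for R/J with R noetherian) *)
Definition depth (J : ideal_of) : nat :=
  match excluded_middle_informative
          (exists m, forall d, has_regseq J d -> (d <= m)%N) with
  | left H =>
      let m := proj1_sig (constructive_indefinite_description _ H) in
      (\max_(d < m.+1 | asb (has_regseq J d)) d)%N
  | right _ => 0%N
  end.

Definition squarefree_mon (m : 'X_{1..n}) : bool := [forall i, (m i <= 1)%N].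

Definition monomial_ideal (g : seq 'X_{1..n}) : ideal_of :=
  gen_ideal (fun f => exists2 m, m \in g & f = 'X_[m]).

End Defs.

Definition in_E (s t : nat) : Prop :=
  exists i, (1 <= i)%N /\ (i * (s - 1) + 1 <= t <= i * s)%N.

(* Main.v *)
Require Import Defs.
From HB Require Import structures.
From mathcomp Require Import all_boot all_order all_algebra.
From mathcomp Require Import mpoly.
From mathcomp Require Import ring.
From Stdlib Require Import Classical ClassicalEpsilon FunctionalExtensionality PropExtensionality.

(** The variables form [s] blocks [X_l, y_l] with [X_l] of size [r = s - 1]; write
    [u_l] for the product of [X_l]. The minimal primes of [I] are generated by the
    blocks and by the transversals of [X_1, ..., X_s], so a monomial lies in [I^(t)]
    iff it has degree at least [t] in each block and the minimal exponents in
    [X_1, ..., X_s] add up to at least [t].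

    The differences [y_1 - y_l] form a regular sequence of length [s - 1] on
    [R/I^(t)] for all [t > 0]. If [(s-1) i < t <= s i] for some [i], then
    [(u_1 ... u_s)^i y_1^(s (t - (s-1) i) - 1)] is a socle element of the quotient,
    and the depth is [s - 1]. Otherwise a monomial whose minimal exponents add up
    to at least [t] has degree at least [t] in some [X_l]; multiplication by [u_l]
    does not change the conditions on the [y]'s, and [y_1 + u_1 + ... + u_s] is one
    more regular element.

    All maximal regular sequences have the same length because a regular sequence
    of length [d] kills the Koszul cohomology in degrees below [d], while a socle
    element modulo it produces a nonzero class in degree [d]. *)

Set Implicit Arguments.
Unset Strict Implicit.
Unset Printing Implicit Defensive.

Import GRing.Theory.
Local Open Scope ring_scope.

(** * Koszul cohomology and regular sequences *)

Section Koszul.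
Variable R : comNzRingType.
Implicit Types (J : R -> Prop) (ys cs fs : seq R) (f g : R).

Definition ideal_pred J : Prop :=
  [/\ J 0, (forall a b, J a -> J b -> J (a + b)) & (forall r a, J a -> J (r * a))].

Definition adjoin J f : R -> Prop := fun g => exists r, J (g - r * f).

Fixpoint adjoins J fs : R -> Prop :=
  if fs is f :: fs' then adjoins (adjoin J f) fs' else J.

Definition nonzerodiv J f := forall g, J (f * g) -> J g.

(** Properness of the final ideal is kept apart, as a separate clause of [regular_seqP]. *)
Fixpoint rseq J fs : Prop :=
  if fs is f :: fs' then nonzerodiv J f /\ rseq (adjoin J f) fs' else True.

Lemma ideal_predN J a : ideal_pred J -> J a -> J (- a).
Proof. by case=> _ _ JM Ja; rewrite -mulN1r; apply: JM. Qed.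

Lemma ideal_predB J a b : ideal_pred J -> J a -> J b -> J (a - b).
Proof. by move=> idJ Ja /(ideal_predN idJ); case: idJ => _ JD _; apply: JD. Qed.

Lemma adjoin_ideal J f : ideal_pred J -> ideal_pred (adjoin J f).
Proof.
case=> J0 JD JM; split; first by exists 0; rewrite mul0r subr0.
- move=> a b [r Ja] [r' Jb]; exists (r + r').
  by rewrite mulrDl opprD addrACA; apply: JD.
- move=> c a [r Ja]; exists (c * r).
  by rewrite -mulrA -mulrBr; apply: JM.
Qed.

Lemma sub_adjoin J f a : J a -> adjoin J f a.
Proof. by move=> Ja; exists 0; rewrite mul0r subr0. Qed.

Lemma mem_adjoin J f : ideal_pred J -> adjoin J f f.
Proof. by case=> J0 _ _; exists 1; rewrite mul1r subrr. Qed.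

Lemma adjoins_ideal J fs : ideal_pred J -> ideal_pred (adjoins J fs).
Proof. by elim: fs J => //= f fs IH J idJ; apply/IH/adjoin_ideal. Qed.

Lemma sub_adjoins J fs a : J a -> adjoins J fs a.
Proof. by elim: fs J => //= f fs IH J Ja; apply/IH/sub_adjoin. Qed.

Lemma mem_adjoins J fs f : ideal_pred J -> f \in fs -> adjoins J fs f.
Proof.
elim: fs J => //= e fs IH J idJ; rewrite inE => /predU1P[-> | fs_f].
  by apply/sub_adjoins/mem_adjoin.
by apply: IH => //; apply: adjoin_ideal.
Qed.

Lemma adjoins_min J (A : R -> Prop) fs :
    ideal_pred A -> (forall a, J a -> A a) -> (forall f, f \in fs -> A f) ->
  forall a, adjoins J fs a -> A a.
Proof.
move=> idA; have [_ AD AM] := idA.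
elim: fs J => [|f fs IH] J JA fsA a /=; first exact: JA.
apply: IH => [b [r /JA Ab]|b fs_b]; last by apply: fsA; rewrite inE fs_b orbT.
rewrite -[b](subrK (r * f)); apply: AD => //; apply: AM.
by apply: fsA; rewrite mem_head.
Qed.

(* The Koszul cochain complex of [ys], as an iterated mapping cone. *)
Fixpoint kos ys : lmodType R :=
  if ys is _ :: ys' then (kos ys' * kos ys')%type else R^o.

Fixpoint kosd ys : kos ys -> kos ys :=
  match ys with
  | [::] => fun=> 0
  | y :: ys' => fun z : kos ys' * kos ys' => (kosd z.1, y *: z.1 - kosd z.2)
  end.

(* Contraction by [cs]: a null-homotopy of multiplication by [\sum_i c_i y_i]. *)
Fixpoint kosh cs ys : kos ys -> kos ys :=
  match ys with
  | [::] => fun=> 0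
  | y :: ys' => fun z : kos ys' * kos ys' =>
      (head 0 cs *: z.2 + kosh (behead cs) z.1, - kosh (behead cs) z.2)
  end.

Fixpoint kos_in J ys : kos ys -> Prop :=
  match ys with
  | [::] => J
  | y :: ys' => fun z : kos ys' * kos ys' => kos_in J z.1 /\ kos_in J z.2
  end.

(* [z] lives in cohomological degrees [< d]; the predecessor is harmless at
   [d = 0], where all components vanish. *)
Fixpoint kos_lt ys : nat -> kos ys -> Prop :=
  match ys with
  | [::] => fun d (a : R^o) => d = 0%N -> a = 0
  | y :: ys' => fun d (z : kos ys' * kos ys') => kos_lt d z.1 /\ kos_lt d.-1 z.2
  end.

Lemma kosdD ys (a b : kos ys) : kosd (a + b) = kosd a + kosd b.
Proof.
elim: ys a b => [|y ys IH] /= a b; first by rewrite addr0.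
rewrite !IH; congr (_, _); rewrite scalerDr opprD.
by rewrite addrACA.
Qed.

Lemma kosdZ ys c (a : kos ys) : kosd (c *: a) = c *: kosd a.
Proof.
elim: ys a => [|y ys IH] /= a; first by rewrite scaler0.
by rewrite !IH; congr (_, _); rewrite /= scalerBr !scalerA mulrC.
Qed.

Lemma kosdB ys (a b : kos ys) : kosd (a - b) = kosd a - kosd b.
Proof. by rewrite -scaleN1r kosdD kosdZ scaleN1r. Qed.

Lemma kosd0 ys : kosd (0 : kos ys) = 0.
Proof. by rewrite -(scale0r (0 : kos ys)) kosdZ !scale0r. Qed.

Lemma koshD cs ys (a b : kos ys) : kosh cs (a + b) = kosh cs a + kosh cs b.
Proof.
elim: ys cs a b => [|y ys IH] cs /= a b; first by rewrite addr0.
by rewrite !IH; congr (_, _); rewrite /= ?scalerDr ?opprD // addrACA.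
Qed.

Lemma koshZ cs ys c (a : kos ys) : kosh cs (c *: a) = c *: kosh cs a.
Proof.
elim: ys cs a => [|y ys IH] cs /= a; first by rewrite scaler0.
by rewrite !IH; congr (_, _); rewrite /= ?scalerDr ?scalerN // !scalerA mulrC.
Qed.

Lemma koshB cs ys (a b : kos ys) : kosh cs (a - b) = kosh cs a - kosh cs b.
Proof. by rewrite -scaleN1r koshD koshZ scaleN1r. Qed.

Lemma kosd_kosd ys (a : kos ys) : kosd (kosd a) = 0.
Proof.
elim: ys a => [|y ys IH] //= a.
by rewrite IH kosdB kosdZ IH subr0 subrr.
Qed.

Lemma kosdh cs ys (a : kos ys) : size cs = size ys ->
  kosd (kosh cs a) + kosh cs (kosd a) = (\sum_(p <- zip cs ys) p.1 * p.2) *: a.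
Proof.
elim: ys cs a => [|y ys IH] [|c cs] //= a; first by rewrite big_nil scale0r addr0.
case=> eq_sz; rewrite big_cons /=; case: a => a b /=.
set S := \sum_(_ <- _) _; have {}IH x : S *: x = _ := esym (IH cs x eq_sz).
have -> : (c * y + S) *: ((a, b) : kos ys * kos ys) = ((c * y + S) *: a, (c * y + S) *: b) by [].
congr (_, _) => /=; rewrite scalerDl IH.
  rewrite kosdD kosdZ scalerBr scalerA /=.
  by rewrite (AC (2*(2*1)) ((1*4)*(3*(2*5)))) /= subrr add0r.
rewrite -[- kosh cs b]scaleN1r kosdZ scaleN1r opprK koshB koshZ scalerDr scalerA.
by rewrite opprB mulrC (AC ((2*1)*2) ((2*5)*(1*(3*4)))) /= subrr add0r.
Qed.

Lemma kos_in_sub J J' ys (a : kos ys) :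
  (forall r, J r -> J' r) -> kos_in J a -> kos_in J' a.
Proof.
move=> JJ'; elim: ys a => [|y ys IH] /= a; first exact: JJ'.
by case=> /IH ? /IH.
Qed.

Lemma kos_in0 J ys : ideal_pred J -> kos_in J (0 : kos ys).
Proof. by case=> J0 _ _; elim: ys. Qed.

Lemma kos_inD J ys (a b : kos ys) :
  ideal_pred J -> kos_in J a -> kos_in J b -> kos_in J (a + b).
Proof.
case=> _ JD _; elim: ys a b => [|y ys IH] /= a b; first exact: JD.
by case=> a1 a2 [b1 b2]; split; apply: IH.
Qed.

Lemma kos_inZ J ys c (a : kos ys) :
  ideal_pred J -> kos_in J a -> kos_in J (c *: a).
Proof.
case=> _ _ JM; elim: ys a => [|y ys IH] /= a; first exact: JM.
by case=> a1 a2; split; apply: IH.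
Qed.

Lemma kos_inB J ys (a b : kos ys) :
  ideal_pred J -> kos_in J a -> kos_in J b -> kos_in J (a - b).
Proof.
by move=> idJ Ja Jb; apply: kos_inD => //; rewrite -scaleN1r; apply: kos_inZ.
Qed.

Lemma kos_in_d J ys (a : kos ys) : ideal_pred J -> kos_in J a -> kos_in J (kosd a).
Proof.
move=> idJ; elim: ys a => [|y ys IH] /= a; first by case: idJ.
case=> a1 a2; split; first exact: IH.
by apply: kos_inB => //; [apply: kos_inZ | apply: IH].
Qed.

Lemma kos_in_h J cs ys (a : kos ys) :
  ideal_pred J -> kos_in J a -> kos_in J (kosh cs a).
Proof.
move=> idJ; elim: ys cs a => [|y ys IH] cs /= a; first by case: idJ.
case=> a1 a2; split; first by apply: kos_inD => //; [apply: kos_inZ | apply: IH].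
by rewrite -scaleN1r; apply: kos_inZ => //; apply: IH.
Qed.

Lemma kos_in_nzd J f ys (a : kos ys) :
  nonzerodiv J f -> kos_in J (f *: a) -> kos_in J a.
Proof.
move=> nzd; elim: ys a => [|y ys IH] /= a; first exact: nzd.
by case=> /IH ? /IH.
Qed.

Lemma kos_lt0 ys d : kos_lt d (0 : kos ys).
Proof. by elim: ys d => //= y ys IH d; split; apply: IH. Qed.

Lemma kos_ltD ys d (a b : kos ys) : kos_lt d a -> kos_lt d b -> kos_lt d (a + b).
Proof.
elim: ys d a b => [|y ys IH] d /= a b; last first.
  by case=> a1 a2 [b1 b2]; split; apply: IH.
by move=> a0 b0 d0; rewrite a0 ?b0 ?addr0.
Qed.

Lemma kos_ltZ ys d c (a : kos ys) : kos_lt d a -> kos_lt d (c *: a).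
Proof.
elim: ys d a => [|y ys IH] d /= a; last by case=> a1 a2; split; apply: IH.
by move=> a0 d0; rewrite a0 ?scaler0.
Qed.

Lemma kos_ltB ys d (a b : kos ys) : kos_lt d a -> kos_lt d b -> kos_lt d (a - b).
Proof.
by move=> ? ?; apply: kos_ltD => //; rewrite -scaleN1r; apply: kos_ltZ.
Qed.

Lemma kos_lt0P ys (a : kos ys) : kos_lt 0 a -> a = 0.
Proof.
elim: ys a => [|y ys IH] /= a; first exact.
by case: a => a b [/= /IH-> /IH->].
Qed.

Lemma kos_lt_d ys d (a : kos ys) : kos_lt d.-1 a -> kos_lt d (kosd a).
Proof.
elim: ys d a => [|y ys IH] d //= a [a1 a2]; split; first exact: IH.
by apply: kos_ltB; [apply: kos_ltZ | apply: IH].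
Qed.

Lemma kos_lt_h cs ys d (a : kos ys) : kos_lt d a -> kos_lt d.-1 (kosh cs a).
Proof.
elim: ys cs d a => [|y ys IH] cs d //= a [a1 a2]; split.
  by apply: kos_ltD; [apply: kos_ltZ | apply: IH].
by rewrite -scaleN1r; apply: kos_ltZ; apply: IH.
Qed.

(** The entries of [a] are divided by [f] modulo [J] one by one. Entries forced to vanish get
    quotient 0, which keeps [b] in the degrees of [a]. *)
Lemma kos_in_adjoin J f ys d (a : kos ys) : ideal_pred J ->
  kos_lt d a -> kos_in (adjoin J f) a ->
  exists2 b, kos_lt d b & kos_in J (a - f *: b).
Proof.
move=> idJ; elim: ys d a => [|y ys IH] d /= a.
  have [->|d_gt0] := eqVneq d 0%N.
    move=> /(_ erefl)-> _; exists 0 => //; rewrite scaler0 subr0; exact: (kos_in0 [::]).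
  by move=> _ [r Jr]; exists r => [d0|]; [rewrite d0 in d_gt0 | rewrite /GRing.scale /= mulrC].
case=> a1 a2 [/(IH _ _ a1)[b1 ? ?] /(IH _ _ a2)[b2 ? ?]].
by exists (b1, b2).
Qed.

(* [H^i(ys; R/J) = 0] for all [i < d] *)
Definition kos_exact J ys d := forall z : kos ys,
  kos_lt d z -> kos_in J (kosd z) ->
  exists2 w, kos_lt d.-1 w & kos_in J (z - kosd w).

Definition comb ys f :=
  exists2 cs, size cs = size ys & f = \sum_(p <- zip cs ys) p.1 * p.2.

(* Multiplication by [f] is null-homotopic, so a cocycle [z] satisfies
   [f z = d (h z)], and one divides [h z] by [f] using the exactness modulo [f]. *)
Lemma rseq_kos_exact J ys fs : ideal_pred J ->
  (forall f, f \in fs -> comb ys f) -> rseq J fs -> kos_exact J ys (size fs).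
Proof.
elim: fs J => [|f fs IH] J idJ fs_ys /=.
  move=> _ z /kos_lt0P-> _; exists 0; first exact: kos_lt0.
  by rewrite kosd0 subr0; apply: kos_in0.
case=> nzd rsq z ltz dz.
have [cs eq_sz def_f] := fs_ys _ (mem_head _ _).
have def_fz := kosdh z eq_sz; rewrite -def_f in def_fz.
have lthz : kos_lt (size fs) (kosh cs z) by apply: (@kos_lt_h cs ys (size fs).+1).
(* Modulo [f] the element [kosh cs z] is a cocycle: its differential is [f *: z] minus the
   contraction of [kosd z], whose entries lie in [J]. *)
have [||w ltw Jw] := IH (adjoin J f) (adjoin_ideal f idJ) _ rsq _ lthz.
- by move=> e fs_e; apply: fs_ys; rewrite inE fs_e orbT.
- rewrite -[kosd _](addrK (kosh cs (kosd z))) def_fz.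
  apply: kos_inB; [exact: adjoin_ideal| |].
    elim: (ys) (z) => [|y l IHl] a /=; last by split; apply: IHl.
    by exists a; rewrite /GRing.scale /= mulrC subrr; case: idJ.
  by apply: (kos_in_sub (sub_adjoin f)); apply: kos_in_h.
have lthw : kos_lt (size fs) (kosh cs z - kosd w).
  by apply: kos_ltB; [exact: lthz | exact: kos_lt_d].
have [w' ltw' Jw'] := kos_in_adjoin idJ lthw Jw.
(* Applying [kosd] to [kosh cs z - kosd w - f *: w'] removes [w] and puts [f] times [z - kosd w']
   into [J]. *)
exists w' => //; apply: (kos_in_nzd nzd); rewrite scalerBr -def_fz -kosdZ.
rewrite addrAC; apply: kos_inD => //; last exact: kos_in_h.
rewrite -kosdB; have := kos_in_d idJ Jw'.
by rewrite !kosdB kosd_kosd subr0.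
Qed.

(** * Top cohomology, and the bound by the number of generators *)

Fixpoint kos_top ys : kos ys -> R :=
  match ys with
  | [::] => id
  | y :: ys' => fun z : kos ys' * kos ys' => kos_top z.2
  end.

Fixpoint kos_of_top ys (c : R) : kos ys :=
  match ys with
  | [::] => c
  | y :: ys' => ((0, kos_of_top ys' c) : kos ys' * kos ys')
  end.

Lemma kos_topB ys (a b : kos ys) : kos_top (a - b) = kos_top a - kos_top b.
Proof. by elim: ys a b => //= y ys IH a b; rewrite IH. Qed.

Lemma kos_topZ ys c (a : kos ys) : kos_top (c *: a) = c * kos_top a.
Proof. by elim: ys a => //= y ys IH a; rewrite IH. Qed.

Lemma kosd_of_top ys c : kosd (kos_of_top ys c) = 0.
Proof. by elim: ys => //= y ys IH; rewrite IH kosd0 scaler0 subrr. Qed.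

Lemma kos_of_topK ys c : kos_top (kos_of_top ys c) = c.
Proof. by elim: ys. Qed.

Lemma kos_lt_of_top ys c : kos_lt (size ys).+1 (kos_of_top ys c).
Proof. by elim: ys => //= y ys IH; split=> //; apply: kos_lt0. Qed.

Lemma kos_in_top J ys (a : kos ys) : kos_in J a -> J (kos_top a).
Proof. by elim: ys a => //= y ys IH a [_ /IH]. Qed.

Lemma kos_top_d (A : R -> Prop) ys (a : kos ys) : ideal_pred A ->
  (forall y, y \in ys -> A y) -> A (kos_top (kosd a)).
Proof.
move=> idA; have [A0 AD AM] := idA.
elim: ys a => [|y ys IH] //= a ysA; rewrite kos_topB kos_topZ.
apply: ideal_predB => //; first by rewrite mulrC; apply/AM/ysA/mem_head.
by apply: IH => x ys_x; apply: ysA; rewrite inE ys_x orbT.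
Qed.

Lemma rseq_take J fs d : rseq J fs -> rseq J (take d fs).
Proof. by elim: fs J d => [|f fs IH] J [|d] //= [? ?]; split=> //; apply: IH. Qed.

(** In top degree 1 gives a cocycle, while coboundaries have top entry in [A] by [kos_top_d]. A
    longer regular sequence would make this cocycle a coboundary modulo [J], forcing 1 into [A]. *)
Lemma rseq_size_le J ys fs : ideal_pred J ->
    (forall f, f \in fs -> comb ys f) -> rseq J fs ->
  (exists A : R -> Prop, [/\ ideal_pred A, ~ A 1, forall a, J a -> A a
     & forall y, y \in ys -> A y]) -> (size fs <= size ys)%N.
Proof.
move=> idJ fs_ys rsq [A [idA A1 JA ysA]]; rewrite leqNgt; apply/negP=> lt_ys.
have /rseq_kos_exact ex := rseq_take (size ys).+1 rsq.
have := ex _ idJ; rewrite size_takel // => {}ex.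
have [||w _] := ex ys _ (kos_of_top ys 1) (kos_lt_of_top _ _).
- by move=> f /mem_take; apply: fs_ys.
- by rewrite kosd_of_top; apply: kos_in0.
move=> /kos_in_top; rewrite kos_topB kos_of_topK => /JA J1.
apply: A1; rewrite -[1](subrK (kos_top (kosd w))).
by case: (idA) => _ AD _; apply: AD => //; apply: kos_top_d.
Qed.

(** * Socle elements and the first nonvanishing cohomology *)

Fixpoint kos_bot ys (c : R) : kos ys :=
  match ys with
  | [::] => c
  | y :: ys' => ((kos_bot ys' c, 0) : kos ys' * kos ys')
  end.

Lemma kos_in_bot J ys c : kos_in J (kos_bot ys c) -> J c.
Proof. by elim: ys => //= y ys IH [/IH]. Qed.

Lemma kos_lt_bot ys c : kos_lt 1 (kos_bot ys c).
Proof. by elim: ys => //= y ys IH; split=> //; apply: kos_lt0. Qed.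

Lemma kos_in_d_bot J ys c : ideal_pred J ->
  (forall y, y \in ys -> J (y * c)) -> kos_in J (kosd (kos_bot ys c)).
Proof.
move=> idJ; elim: ys => [|y ys IH] Jys /=; first by case: idJ.
split; first by apply: IH => x ys_x; apply: Jys; rewrite inE ys_x orbT.
rewrite kosd0 subr0; have := Jys _ (mem_head _ _); elim: (ys) => //= x l IHl Jc.
by rewrite scaler0; split; [apply: IHl | apply: kos_in0].
Qed.

(** For empty [fs], [v] is a nonzero class in degree 0. Otherwise exactness modulo [J] would pass to
    [adjoin J f] in one degree less, through the connecting map for multiplication by [f]. *)
Lemma socle_not_kos_exact J ys fs v : ideal_pred J ->
    (forall f, f \in fs -> comb ys f) -> rseq J fs ->
    ~ adjoins J fs v -> (forall y, y \in ys -> adjoins J fs (y * v)) ->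
  ~ kos_exact J ys (size fs).+1.
Proof.
elim: fs J => [|f fs IH] J idJ fs_ys rsq Jv ys_v /= ex.
  have [|w /kos_lt0P->] := ex (kos_bot ys v) (kos_lt_bot ys v).
    exact: kos_in_d_bot.
  by rewrite kosd0 subr0 => /kos_in_bot.
have ex' := rseq_kos_exact idJ fs_ys rsq; case: rsq => nzd rsq.
apply: (IH _ (adjoin_ideal f idJ) _ rsq Jv ys_v) => [e fs_e|z ltz Jz].
  by apply: fs_ys; rewrite inE fs_e orbT.
(* Dividing [kosd z] by [f] gives [w], again a cocycle as [f] is a nonzerodivisor. It is the
   coboundary of some [w'], so [z - f *: w'] is a cocycle modulo [J], to which [ex'] applies. *)
have [w ltw Jw] := kos_in_adjoin idJ (@kos_lt_d ys (size fs).+2 z ltz) Jz.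
have [|w' ltw' Jw'] := ex w ltw.
  apply: (kos_in_nzd nzd); have := kos_in_d idJ Jw.
  rewrite kosdB kosd_kosd kosdZ sub0r -scaleN1r => /(kos_inZ (-1) idJ).
  by rewrite scalerA mulrNN mulr1 scale1r.
have [||w'' ltw'' Jw''] := ex' (z - f *: w').
- by apply: kos_ltB => //; apply: kos_ltZ.
- rewrite kosdB kosdZ -[kosd z](subrK (f *: w)) -addrA -scalerBr.
  by apply: kos_inD => //; apply: kos_inZ.
exists w'' => //; rewrite -[z](subrK (f *: w')) addrAC.
apply: kos_inD; first exact: adjoin_ideal.
  exact: (kos_in_sub (sub_adjoin f)).
elim: (ys) (w') => [|y l IHl] a /=; last by split; apply: IHl.
by exists a; rewrite /GRing.scale /= mulrC subrr; case: idJ.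
Qed.

Lemma socle_rseq_size_le J ys fs v gs : ideal_pred J ->
    (forall f, f \in fs -> comb ys f) -> rseq J fs ->
    ~ adjoins J fs v -> (forall y, y \in ys -> adjoins J fs (y * v)) ->
    (forall f, f \in gs -> comb ys f) -> rseq J gs ->
  (size gs <= size fs)%N.
Proof.
move=> idJ fs_ys rsq Jv ys_v gs_ys rsqg; rewrite leqNgt; apply/negP=> lt_fs.
apply: (socle_not_kos_exact idJ fs_ys rsq Jv ys_v).
rewrite -(size_takel lt_fs); apply: rseq_kos_exact => //; last exact: rseq_take.
by move=> f /mem_take; apply: gs_ys.
Qed.

End Koszul.

(** * Depth *)

Section Depth.
Variables (k : fieldType) (n : nat).
Local Notation P := {mpoly k[n]}.
Implicit Types (J S A : P -> Prop) (fs : seq P).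

Lemma gen_ideal_ideal S : ideal_pred (gen_ideal S).
Proof.
split; first by exists [::]; rewrite big_nil.
- move=> a b [la [Sa ->]] [lb [Sb ->]]; exists (la ++ lb); rewrite big_cat; split=> //.
  by move=> p; rewrite mem_cat => /orP[/Sa | /Sb].
- move=> r a [la [Sa ->]]; exists [seq (r * p.1, p.2) | p <- la]; split.
    by move=> p /mapP[q /Sa Sq ->].
  by rewrite big_map big_distrr; apply: eq_bigr => p _ /=; rewrite mulrA.
Qed.

Lemma mem_gen_ideal S f : S f -> gen_ideal S f.
Proof.
move=> Sf; exists [:: (1, f)]; rewrite big_seq1 mul1r; split=> // p.
by rewrite inE => /eqP->.
Qed.

Lemma ideal_pred_sum A (I : eqType) (r : seq I) (F : I -> P) : ideal_pred A ->
  (forall i, i \in r -> A (F i)) -> A (\sum_(i <- r) F i).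
Proof.
case=> A0 AD _ AF; rewrite big_seq; elim/big_ind: _ => //; exact: AF.
Qed.

Lemma gen_ideal_min S A : ideal_pred A -> (forall f, S f -> A f) ->
  forall f, gen_ideal S f -> A f.
Proof.
move=> idA SA f [l [Sl ->]]; apply: ideal_pred_sum => // p /Sl/SA Ap.
by case: idA => _ _; apply.
Qed.

Lemma ideal_add_seqE J fs f : ideal_pred J ->
  ideal_add_seq J fs f <-> adjoins J fs f.
Proof.
move=> idJ; split.
  apply: gen_ideal_min; first exact: adjoins_ideal.
  by move=> g [/sub_adjoins|/mem_adjoins]; apply.
apply: adjoins_min; first exact: gen_ideal_ideal.
- by move=> a Ja; apply: mem_gen_ideal; left.
- by move=> g fs_g; apply: mem_gen_ideal; right.
Qed.

Lemma rseqP J fs :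
  (forall i, (i < size fs)%N -> forall g,
     adjoins J (take i fs) (fs`_i * g) -> adjoins J (take i fs) g) <-> rseq J fs.
Proof.
elim: fs J => [|f fs IH] J; first by split.
split=> [reg | [nzd /IH reg] [|i]] //=; last by move=> /reg.
split; first exact: (reg 0%N).
by apply/IH => i lt_i; apply: (reg i.+1).
Qed.

Lemma regular_seqP J fs : ideal_pred J ->
  regular_seq J fs <->
  [/\ forall f, f \in fs -> max_homog f, rseq J fs & ~ adjoins J fs 1].
Proof.
move=> idJ; rewrite /regular_seq.
have E l f := @ideal_add_seqE J l f idJ.
split=> -[fs_m reg fs1]; split=> //; try by rewrite E in fs1 *.
  by apply/rseqP => i lt_i g /E/reg-/(_ lt_i)/E.
by move=> i lt_i g /E Ji; apply/E; move/rseqP: reg; apply.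
Qed.

Definition vars : seq P := [seq 'X_i | i <- enum 'I_n].

(** A member of the ideal may be written with repeated variables, while [kosh] takes one coefficient
    per entry of [vars]; the terms are collected by variable. *)
Lemma max_homog_comb f : max_homog f -> comb vars f.
Proof.
suff comb_sum (c : 'I_n -> P) : comb vars (\sum_i c i * 'X_i).
  case=> l [lP ->] {f}; elim: l lP => [|p l IH] lP.
    have := comb_sum (fun=> 0); rewrite big_nil big1 // => i _; exact: mul0r.
  suff [c ->] : exists c : 'I_n -> P, \sum_(p <- p :: l) p.1 * p.2 = \sum_i c i * 'X_i.
    exact: comb_sum.
  elim: {IH} (p :: l) lP => [|q l' IH] lP.
    by exists (fun=> 0); rewrite big_nil big1 // => i _; exact: mul0r.
  have [|c E] := IH; first by move=> r l'_r; apply: lP; rewrite inE l'_r orbT.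
  have [i q2] := lP _ (mem_head _ _).
  exists (fun j => c j + (if j == i then q.1 else 0)).
  rewrite big_cons E q2; under [RHS]eq_bigr do rewrite mulrDl.
  rewrite big_split /= addrC; congr (_ + _); rewrite (bigD1 i) //= eqxx.
  by rewrite big1 ?addr0 // => j /negPf->; rewrite mul0r.
exists [seq c i | i <- enum 'I_n]; first by rewrite !size_map.
by rewrite zip_map big_map big_enum.
Qed.

Lemma regular_seq_max J d : ideal_pred J -> has_regseq J d ->
  exists fs, [/\ size fs = d, forall f, f \in fs -> comb vars f & rseq J fs].
Proof.
move=> idJ [fs [sz_fs /(regular_seqP _ idJ)[fs_m reg _]]]; exists fs; split=> //.
by move=> f /fs_m/max_homog_comb.
Qed.

(** The homogeneous maximal ideal in a form that makes its properness immediate. *)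
Definition irrelevant (f : P) := f@_0%MM = 0.

Lemma irrelevant_ideal : ideal_pred irrelevant.
Proof.
rewrite /irrelevant; split; first by rewrite mcoeff0.
- by move=> a b a0 b0; rewrite mcoeffD a0 b0 addr0.
- by move=> r a a0; rewrite rmorphM /= a0 mulr0.
Qed.

Lemma irrelevant1 : ~ irrelevant 1.
Proof. by rewrite /irrelevant mcoeff1 eqxx => /eqP; rewrite oner_eq0. Qed.

Lemma irrelevantX i : irrelevant 'X_i.
Proof. by rewrite /irrelevant mcoeffX mnm1_eq0. Qed.

Lemma max_homog_irrelevant f : max_homog f -> irrelevant f.
Proof.
by apply: gen_ideal_min => [|_ [i ->]]; [apply: irrelevant_ideal | apply: irrelevantX].
Qed.

Lemma has_regseqP J fs : ideal_pred J -> (forall f, J f -> irrelevant f) ->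
  (forall f, f \in fs -> max_homog f) -> rseq J fs -> has_regseq J (size fs).
Proof.
move=> idJ Jm fs_m reg; exists fs; split=> //; apply/regular_seqP => //; split=> //.
move=> fs1; apply: irrelevant1; move: fs1; apply: adjoins_min => //.
  exact: irrelevant_ideal.
by move=> f /fs_m/max_homog_irrelevant.
Qed.

(** The variables and [J] lie in the proper ideal [irrelevant], so [rseq_size_le] applies. *)
Lemma has_regseq_le J d : ideal_pred J -> (forall f, J f -> irrelevant f) ->
  has_regseq J d -> (d <= n)%N.
Proof.
move=> idJ Jm /(regular_seq_max idJ)[fs [<- fs_m reg]].
rewrite -[leqRHS](size_enum_ord n) -(size_map (fun i => 'X_i : P)).
apply: (rseq_size_le idJ fs_m reg); exists irrelevant; split=> //.
- exact: irrelevant_ideal.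
- exact: irrelevant1.
- by move=> _ /mapP[i _ ->]; apply: irrelevantX.
Qed.

Lemma has_regseq_le_socle J fs v d : ideal_pred J ->
    (forall f, f \in fs -> max_homog f) -> rseq J fs ->
    ~ adjoins J fs v -> (forall i, adjoins J fs ('X_i * v)) ->
  has_regseq J d -> (d <= size fs)%N.
Proof.
move=> idJ fs_m reg Jv mv /(regular_seq_max idJ)[gs [<- gs_m regg]].
apply: (socle_rseq_size_le idJ _ reg Jv _ gs_m regg) => [f /fs_m/max_homog_comb // |].
by move=> _ /mapP[i _ ->].
Qed.

Lemma asbP (Q : Prop) : reflect Q (asb Q).
Proof. by rewrite /asb; case: excluded_middle_informative => ?; constructor. Qed.

(** The uniform bound [b] rules out the default value 0 of [depth]. *)
Lemma leq_depth J d b : has_regseq J d ->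
  (forall e, has_regseq J e -> (e <= b)%N) -> (d <= depth J)%N.
Proof.
move=> Jd Jb; rewrite /depth; case: excluded_middle_informative => [H|[]]; last by exists b.
case: constructive_indefinite_description => m /= Jm.
have lt_d : (d < m.+1)%N by apply: Jm.
apply: (@leq_bigmax_cond _ (fun e : 'I_m.+1 => asb (has_regseq J e)) (@nat_of_ord _)
  (Ordinal lt_d)).
exact/asbP.
Qed.

Lemma depth_leq J b : (forall e, has_regseq J e -> (e <= b)%N) -> (depth J <= b)%N.
Proof.
move=> Jb; rewrite /depth; case: excluded_middle_informative => [H|//].
by case: constructive_indefinite_description => m /= Jm; apply/bigmax_leqP => d /asbP/Jb.
Qed.

End Depth.

(** * Symbolic powers of squarefree monomial ideals *)

Lemma seq_argmin (T : eqType) (s : seq T) (p : pred T) (v : T -> nat) x0 :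
    x0 \in s -> p x0 ->
  exists x, [/\ x \in s, p x & forall y, y \in s -> p y -> (v x <= v y)%N].
Proof.
move=> s_x0 px0; pose q i := has (fun x => p x && (v x == i)) s.
have exq : exists i, q i by exists (v x0); apply/hasP; exists x0; rewrite // px0 /=.
case: (ex_minnP exq) => i /hasP[x s_x /andP[px /eqP vx]] le_i.
exists x; split=> // y s_y py; rewrite vx; apply: le_i.
by apply/hasP; exists y; rewrite // py /=.
Qed.

Lemma seq_argmax (T : eqType) (s : seq T) (p : pred T) (v : T -> nat) x0 :
    x0 \in s -> p x0 ->
  exists x, [/\ x \in s, p x & forall y, y \in s -> p y -> (v y <= v x)%N].
Proof.
move=> s_x0 px0; pose b := (\max_(x <- s) v x)%N.
have le_b y : y \in s -> (v y <= b)%N by move=> s_y; apply: leq_bigmax_seq.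
have [x [s_x px min_x]] := seq_argmin (fun x => (b - v x)%N) s_x0 px0.
exists x; split=> // y s_y py; have := min_x y s_y py.
by rewrite leq_sub2lE ?le_b.
Qed.

Section MonomialIdeals.
Variables (k : fieldType) (n : nat).
Local Notation P := {mpoly k[n]}.
Implicit Types (A B : pred 'X_{1..n}) (f g h : P) (m : 'X_{1..n}) (F : {set 'I_n}).

Definition monI A : P -> Prop := fun f => forall m, m \in msupp f -> A m.

Definition upclosed A := forall m m', A m -> A (m + m')%MM.

Lemma monI_ideal A : upclosed A -> ideal_pred (monI A).
Proof.
move=> upA; split; first by move=> m; rewrite msupp0.
- by move=> a b Ia Ib m /msuppD_le; rewrite mem_cat => /orP[/Ia | /Ib].
- move=> r a Ia m /msuppM_le/allpairsP[[m1 m2] /= [_ /Ia Am2 ->]].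
  by rewrite addmC; apply: upA.
Qed.

Lemma monIX A m : monI A 'X_[m] <-> A m.
Proof.
split=> [|Am m']; first by apply; rewrite msuppX mem_head.
by move/mem_msuppXP => <-.
Qed.

Lemma monI_min A (I : P -> Prop) : ideal_pred I -> (forall m, A m -> I 'X_[m]) ->
  forall f, monI A f -> I f.
Proof.
move=> idI AI f Af; rewrite [f]mpolyE; apply: ideal_pred_sum => // m /Af/AI Im.
by case: idI => _ _ IM; rewrite -mul_mpolyC; apply: IM.
Qed.

Definition restr A f : P := \sum_(m <- msupp f | A m) f@_m *: 'X_[m].

Lemma mcoeff_restr A f m : (restr A f)@_m = if A m then f@_m else 0.
Proof.
rewrite /restr raddf_sum /=; under eq_bigr do rewrite mcoeffZ mcoeffX.
have [f_m | f'm] := boolP (m \in msupp f); last first.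
  rewrite (memN_msupp_eq0 f'm) if_same big1_seq // => m' /andP[_ f_m'].
  by case: eqP => [Em|_]; [rewrite -Em f_m' in f'm | rewrite mulr0].
rewrite -big_filter; have [Am | A'm] := boolP (A m); last first.
  rewrite big1_seq // => m' /=; rewrite mem_filter => /andP[Am' _].
  by case: eqP => [Em|_]; [rewrite -Em Am' in A'm | rewrite mulr0].
rewrite (bigD1_seq m) ?filter_uniq ?msupp_uniq ?mem_filter ?Am //= eqxx mulr1.
by rewrite big1 ?addr0 // => m' /negPf->; rewrite mulr0.
Qed.

Lemma msupp_restr A f m : (m \in msupp (restr A f)) = A m && (m \in msupp f).
Proof. by rewrite !mcoeff_msupp mcoeff_restr; case: (A m); rewrite ?eqxx. Qed.

Lemma msupp_sub_restr A f m :
  (m \in msupp (f - restr A f)) = ~~ A m && (m \in msupp f).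
Proof.
by rewrite !mcoeff_msupp mcoeffB mcoeff_restr; case: (A m); rewrite ?subrr ?subr0 ?eqxx.
Qed.

(** * Powers of monomial primes *)

Definition wt F m := (\sum_(i in F) m i)%N.

Lemma wtD F m m' : wt F (m + m')%MM = (wt F m + wt F m')%N.
Proof. by rewrite -big_split; apply: eq_bigr => i _; rewrite mnmDE. Qed.

(** This is the [t]-th power of the prime generated by the variables in [F]. *)
Definition wtI F t := monI (fun m => (t <= wt F m)%N).

Lemma wtI_ideal F t : ideal_pred (wtI F t).
Proof.
by apply: monI_ideal => m m' le_t; rewrite wtD (leq_trans le_t) ?leq_addr.
Qed.

Lemma wtIM F s t f g : wtI F s f -> wtI F t g -> wtI F (s + t) (f * g).
Proof.
move=> Ff Fg m /msuppM_le/allpairsP[[m1 m2] /= [/Ff Fm1 /Fg Fm2 ->]].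
by rewrite wtD leq_add.
Qed.

(** Grade by the degree in the variables of [F]. If the lowest part of [f] had degree [w < t], its
    product with the degree 0 part of [g], nonzero as [g] is outside the prime, would be a nonzero
    part of [g * f] in degree [w]. *)
Lemma wtI_primary F t f g : ~ wtI F 1 g -> wtI F t (g * f) -> wtI F t f.
Proof.
move=> Fg Fgf m0 f_m0; rewrite leqNgt; apply/negP => lt_m0.
have [m [f_m _ min_m]] := seq_argmin (wt F) (p := predT) f_m0 isT.
set w := wt F m in min_m; have lt_w : (w < t)%N := leq_ltn_trans (min_m _ f_m0 isT) lt_m0.
pose f0 := restr (fun m => wt F m == w) f; pose g0 := restr (fun m => wt F m == 0%N) g.
have Ff : wtI F w f by move=> m' f_m'; apply: (min_m _ f_m' isT).
have Ff0 : wtI F w.+1 (f - f0).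
  by move=> m'; rewrite msupp_sub_restr => /andP[neq_w /Ff]; rewrite ltn_neqAle eq_sym neq_w.
have Fg0 : wtI F 1 (g - g0).
  by move=> m'; rewrite msupp_sub_restr lt0n => /andP[].
have g0_neq0 : g0 != 0.
  by apply: contra_notN Fg => /eqP g00; rewrite -(subr0 g) -g00.
have f0_neq0 : f0 != 0.
  rewrite -msupp_eq0; apply/eqP=> E; move: (in_nil m).
  by rewrite -E msupp_restr eqxx f_m.
have F0 : wtI F w.+1 (g0 * f0).
  (* All three terms have weight above [w]: the first because [w < t], the others because one factor
     has lost its lowest part. *)
  have -> : g0 * f0 = g * f - (g - g0) * f - g0 * (f - f0) by ring.
  have idF := wtI_ideal F w.+1; apply: (ideal_predB idF); first apply: (ideal_predB idF).
  - by move=> m' /Fgf; apply: (leq_trans lt_w).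
  - exact: (wtIM Fg0 Ff).
  - by case: idF => _ _; apply.
have : g0 * f0 != 0 by rewrite mulf_neq0.
rewrite -msupp_eq0; case E: (msupp _) => [//|m' s] _.
have gf_m' : m' \in msupp (g0 * f0) by rewrite E mem_head.
have /msuppM_le/allpairsP[[m1 m2] /= []] := gf_m'.
rewrite !msupp_restr => /andP[/eqP w1 _] /andP[/eqP w2 _] Em'.
by have := F0 _ gf_m'; rewrite Em' wtD w1 w2 add0n ltnn.
Qed.

Lemma wtI1_N1 F : ~ wtI F 1 1.
Proof.
move/(_ 0%MM); rewrite msupp1 mem_head => /(_ isT).
by rewrite /wt big1 // => i _; rewrite mnm0E.
Qed.

Lemma wtI_prime F : is_prime (wtI F 1).
Proof.
split; [exact: wtI_ideal | exact: wtI1_N1 | move=> a b Fab].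
by case: (classic (wtI F 1 a)) => [|Fa]; [left | right; apply: wtI_primary Fab].
Qed.

Definition indic (C : {set 'I_n}) : 'X_{1..n} := [multinom nat_of_bool (i \in C) | i < n].

Lemma wt_indic F C : wt F (indic C) = #|F :&: C|.
Proof.
rewrite /wt -sum1_card [RHS](eq_bigl (fun i => (i \in F) && (i \in C))).
  by rewrite big_mkcondr; apply: eq_bigr => i _; rewrite mnmE; case: (i \in C).
by move=> i; rewrite inE.
Qed.

Section SymbolicPowers.
Variable Fs : {set {set 'I_n}}.

(** The monomials of these sets generate the intersection of the primes attached to the members of
    [Fs]. *)
Definition hitting (C : {set 'I_n}) := [forall F in Fs, F :&: C != set0].

Definition hitting_gens : seq 'X_{1..n} := [seq indic C | C in hitting].

Lemma hitting_gens_squarefree m : m \in hitting_gens -> squarefree_mon m.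
Proof.
by case/imageP => C _ ->; apply/forallP => i; rewrite mnmE leq_b1.
Qed.

Local Notation I := (@monomial_ideal k n hitting_gens).

Lemma mem_hitting C : hitting C -> I 'X_[indic C].
Proof.
by move=> hitC; apply: mem_gen_ideal; exists (indic C) => //; apply: image_f.
Qed.

Lemma hitting_sub_wtI F f : F \in Fs -> I f -> wtI F 1 f.
Proof.
move=> FsF; apply: gen_ideal_min => [|_ [_ /imageP[C /forall_inP hitC ->] ->]].
  exact: wtI_ideal.
by apply/monIX; rewrite wt_indic lt0n cards_eq0; apply: hitC.
Qed.

Lemma ideal_pow_ideal t : ideal_pred (ideal_pow I t).
Proof. exact: gen_ideal_ideal. Qed.

Lemma ideal_powM t f g : I f -> ideal_pow I t g -> ideal_pow I t.+1 (f * g).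
Proof.
move=> If [l [Il ->]]; have [_ _ JM] := ideal_pow_ideal t.+1.
rewrite big_distrr; apply: ideal_pred_sum => [|p /Il[l' [sz_l' Il' ->]]].
  exact: gen_ideal_ideal.
rewrite /= mulrCA; apply: JM; apply: mem_gen_ideal; exists (f :: l'); split.
- by rewrite /= sz_l'.
- by move=> e; rewrite inE => /predU1P[-> // | /Il'].
- by rewrite big_cons.
Qed.

Lemma ideal_pow_wtI F t f : F \in Fs -> ideal_pow I t f -> wtI F t f.
Proof.
move=> FsF; apply: gen_ideal_min => [|_ [l [<- Il ->]]]; first exact: wtI_ideal.
elim: l Il => [|e l IH] Il; first by rewrite big_nil => m _.
rewrite big_cons -[size _]add1n; apply: wtIM.
  by apply: (hitting_sub_wtI FsF); apply/Il/mem_head.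
by apply: IH => e' l_e'; apply: Il; rewrite inE l_e' orbT.
Qed.

Hypothesis antichain : forall F F', F \in Fs -> F' \in Fs -> F \subset F' -> F = F'.

(** Let [V] consist of the variables in [Q]. If no member of [Fs] were inside [V], the complement of
    [V] would be hitting, and a product of variables outside [Q] would lie in [Q]. *)
Lemma prime_over_wtI Q : is_prime Q -> (forall f, I f -> Q f) ->
  exists2 F, F \in Fs & forall f, wtI F 1 f -> Q f.
Proof.
case=> idQ Q1 Qprime IQ; have [_ _ QM] := idQ.
pose V := [set i | asb (Q 'X_i)].
have [F FsF sFV] : exists2 F, F \in Fs & F \subset V.
  apply/exists_inP; rewrite -[[exists _ in _, _]]negbK negb_exists_in.
  apply/negP => /forall_inP notV.
  have hitV : hitting (~: V).
    apply/forall_inP => F /notV; apply: contraNneq => FV0.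
    apply/subsetP=> i Fi; apply: contraT => V'i.
    by rewrite -(in_set0 i) -FV0 in_setI in_setC Fi V'i.
  have := IQ _ (mem_hitting hitV); rewrite mpolyXE_id.
  elim: (index_enum _) => [|i s IH]; first by rewrite big_nil.
  rewrite big_cons mnmE => /Qprime[|//]; rewrite !inE.
  by case: asbP => //= Qi; rewrite expr0 // expr1.
exists F => // f; apply: monI_min => // m; rewrite lt0n sum_nat_eq0 negb_forall_in.
case/exists_inP => i /(subsetP sFV); rewrite inE => /asbP Qi m_i.
by rewrite -(@submK n U_(i) m) ?lep1mP // mpolyXD; apply: QM.
Qed.

Lemma minimal_primeP Q : minimal_prime I Q ->
  exists2 F, F \in Fs & forall f, Q f <-> wtI F 1 f.
Proof.
case=> Qprime IQ Qmin; have [F FsF FQ] := prime_over_wtI Qprime IQ.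
exists F => // f; split=> [|/FQ//].
by apply: Qmin => // [|g]; [apply: wtI_prime | apply: hitting_sub_wtI].
Qed.

Lemma wtIX F i : wtI F 1 'X_i <-> i \in F.
Proof.
have -> : wtI F 1 'X_i <-> exists2 j, j \in F & U_(i)%MM j != 0%N.
  rewrite /wtI; split=> [/monIX | ex_j]; last apply/monIX.
    by rewrite lt0n sum_nat_eq0 negb_forall_in => /exists_inP.
  by rewrite lt0n sum_nat_eq0 negb_forall_in; apply/exists_inP.
split=> [[j Fj] | Fi]; last by exists i; rewrite // mnm1E eqxx.
by rewrite mnm1E; case: (i =P j) => // ->.
Qed.

(** A prime below this one contains the prime of some [F'] in [Fs]; then [F'] is inside [F], hence
    equal to it. *)
Lemma wtI_minimal_prime F : F \in Fs -> minimal_prime I (wtI F 1).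
Proof.
move=> FsF; split; [exact: wtI_prime | by move=> f; apply: hitting_sub_wtI |].
move=> Q' Q'prime IQ' sQ'F f; have [F' FsF' F'Q'] := prime_over_wtI Q'prime IQ'.
suff <- : F' = F by apply: F'Q'.
by apply: antichain => //; apply/subsetP => i /wtIX/F'Q'/sQ'F/wtIX.
Qed.

(* The monomial [\prod_(i \notin F) 'X_i] is a unit at the prime of [F], and it
   multiplies every ['X_i] with [i \in F] into [I], because [F] is minimal. *)
Lemma clear_denominators F t m : F \in Fs -> (t <= wt F m)%N ->
  ideal_pow I t ('X_[indic (~: F)] ^+ t * 'X_[m]).
Proof.
move=> FsF; elim: t m => [|t IH] m le_t.
  have [_ _ JM] := ideal_pow_ideal 0; rewrite expr0 mulrC; apply: JM.
  by apply: mem_gen_ideal; exists [::]; rewrite big_nil.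
have : wt F m != 0%N by rewrite -lt0n; apply: leq_trans le_t.
rewrite sum_nat_eq0 negb_forall_in => /exists_inP[i Fi mi].
have Em : (m - U_(i) + U_(i))%MM = m by rewrite submK ?lep1mP.
rewrite -Em mpolyXD exprS [_ * 'X_i]mulrC mulrACA; apply: ideal_powM.
  (* A member of [Fs] missing this set would lie in [F] and avoid [i], against the antichain
     condition. *)
  have hit : hitting (i |: ~: F).
    apply/forall_inP => F' FsF'; apply: contraTneq Fi => F'0.
    have nF' j : j \in F' -> (j != i) && (j \in F).
      by move=> F'j; have := in_set0 j; rewrite -F'0 !inE F'j /=; case: eqP; case: (j \in F).
    have <- : F' = F by apply: antichain => //; apply/subsetP=> j /nF'/andP[].
    by apply/negP => /nF'/andP[/eqP].
  rewrite -mpolyXD; have <- : indic (i |: ~: F) = (indic (~: F) + U_(i))%MM.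
    apply/mnmP => j; rewrite mnmDE !mnmE !inE.
    have [->|ji] := eqVneq j i; first by rewrite Fi.
    by rewrite addn0.
  exact: mem_hitting.
apply: IH; move: le_t; rewrite -{1}Em wtD {2}/wt (bigD1 i) //= mnm1E eqxx.
rewrite big1 ?addn0 ?addn1 // => j /andP[_ ji].
by rewrite mnm1E eq_sym (negPf ji).
Qed.

(** The component of the [t]-th power at [F] is [wtI F t]: the latter contains the power and is
    primary, and a monomial outside the prime multiplies it into the power. *)
Lemma sympow_hitting t :
  sympow I t = monI (fun m => [forall F in Fs, (t <= wt F m)%N]).
Proof.
apply: functional_extensionality => f; apply: propositional_extensionality; split.
  move=> symf m f_m; apply/forall_inP => F FsF.
  have [g [Fg Igf]] := symf _ (wtI_minimal_prime FsF).
  by apply: (wtI_primary Fg (ideal_pow_wtI FsF Igf)).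
move=> Af Q /minimal_primeP[F FsF QF]; exists ('X_[indic (~: F)] ^+ t); split.
  move/QF; elim: t {Af} => [|t IH]; first by rewrite expr0; apply: wtI1_N1.
  rewrite exprS => Fh; apply: IH; apply: wtI_primary Fh => /monIX.
  by rewrite wt_indic setICr cards0.
(* For a fixed multiplier the admissible [f] form an ideal, so it suffices to treat monomials. *)
have idI : ideal_pred (fun f => ideal_pow I t ('X_[indic (~: F)] ^+ t * f)).
  have [J0 JD JM] := ideal_pow_ideal t.
  split; first by rewrite mulr0.
  - by move=> a b Ia Ib; rewrite mulrDr; apply: JD.
  - by move=> r a Ia; rewrite mulrCA; apply: JM.
apply: (monI_min idI _ Af) => m /forall_inP Am; apply: clear_denominators => //.
exact: Am.
Qed.

End SymbolicPowers.
End MonomialIdeals.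

(** * Nonzerodivisors modulo monomial ideals *)

Section MonomialNonzerodivisors.
Variables (k : fieldType) (n : nat).
Local Notation P := {mpoly k[n]}.
Implicit Types (A : pred 'X_{1..n}) (f : P) (m : 'X_{1..n}).

Lemma mcoeff_mulX f a m :
  ('X_[a] * f)@_m = if (a <= m)%MM then f@_(m - a)%MM else 0.
Proof.
have [le_am | nle_am] := boolP (a <= m)%MM.
  by rewrite mulrC -{1}(submK le_am) addmC mcoeffMX.
apply: memN_msupp_eq0; apply/negP => /msuppM_le/allpairsP[[m1 m2] /= []].
by rewrite msuppX inE => /eqP-> _ Em; rewrite Em lem_addr in nle_am.
Qed.

(** The coefficient of the product at [m + U_(q)] is that of [f] at [m + U_(q) - U_(p)], if this
    exponent exists, minus that at [m]. It vanishes as [m + U_(q)] is outside [A], and the first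
    term vanishes by induction on the exponent of [p]. *)
Lemma mcoeff_diff_eq0 A (p q : 'I_n) f m : p != q ->
    monI A (('X_p - 'X_q) * f) ->
    (forall m', (forall i, i != p -> i != q -> m' i = m i) -> (m' p <= m p)%N -> ~~ A m') ->
  f@_m = 0.
Proof.
move=> neq_pq Af; have qp : (q == p) = false by rewrite eq_sym (negPf neq_pq).
move Ed: (m p) => d; elim: d m Ed => [|d IH] m Ed badm.
all: have : ~~ A (m + U_(q))%MM by apply: badm => [i _ iq|];
  rewrite mnmDE mnm1E ?qp ?Ed ?addn0 // [q == i]eq_sym (negPf iq) addn0.
all: move/(contra (Af _)); rewrite -mcoeff_eq0 mulrBl mcoeffB !mcoeff_mulX lem_addl addmK.
all: rewrite lep1mP mnmDE mnm1E qp addn0 Ed /=.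
  by rewrite sub0r oppr_eq0 => /eqP.
rewrite IH ?sub0r ?oppr_eq0 => [/eqP //||m' agr le_m'].
  by rewrite mnmBE mnmDE !mnm1E eqxx qp addn0 Ed subn1.
apply: badm => [i ip iq|]; last exact: leqW.
rewrite agr // mnmBE mnmDE !mnm1E [q == i]eq_sym [p == i]eq_sym.
by rewrite (negPf ip) (negPf iq) addn0 subn0.
Qed.

Lemma nonzerodiv_diff A (p q : 'I_n) : p != q ->
    (forall m, ~~ A m ->
       (forall m', (forall i, i != p -> i != q -> m' i = m i) -> (m' p <= m p)%N -> ~~ A m') \/
       (forall m', (forall i, i != p -> i != q -> m' i = m i) -> (m' q <= m q)%N -> ~~ A m')) ->
  nonzerodiv (monI A) ('X_p - 'X_q : P).
Proof.
move=> neq_pq badA f Af m; rewrite mcoeff_msupp; apply: contraR => /badA[bad | bad].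
  by rewrite (mcoeff_diff_eq0 neq_pq Af bad).
(* The second alternative is the first one for the opposite difference. *)
rewrite (mcoeff_diff_eq0 (A := A) (p := q) (q := p)) ?[q == p]eq_sym //.
  rewrite -opprB mulNr => m' Am'; apply: Af; by rewrite -(perm_mem (msuppN _)).
by move=> m' agr; apply: bad => i ip iq; apply: agr.
Qed.

(** By uniqueness only the summand [i0] contributes to this coefficient, so nothing cancels it. *)
Lemma mem_msupp_sumM (I : finType) (a : I -> 'X_{1..n}) f m i0 : m \in msupp f ->
    (forall i m', m' \in msupp f -> (m' + a i = m + a i0)%MM -> i = i0) ->
  (m + a i0)%MM \in msupp ((\sum_i 'X_[a i]) * f).
Proof.
move=> f_m uniq_i0; rewrite mcoeff_msupp mulr_suml raddf_sum (bigD1 i0) //=.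
rewrite mcoeff_mulX lem_addl addmK big1 ?addr0 -?mcoeff_msupp // => i ne_i.
rewrite mcoeff_mulX; case: ifP => // le_ai; apply: memN_msupp_eq0.
by apply: contra_neqN ne_i => /uniq_i0; apply; rewrite submK.
Qed.

Lemma comp_mpoly_congr (G : P -> Prop) (a : n.-tuple P) f : ideal_pred G ->
  (forall i, G ('X_i - tnth a i)) -> G (f - (f \mPo a)).
Proof.
move=> idG Ga; have [G0 GD GM] := idG.
have congM x x' y y' : G (x - x') -> G (y - y') -> G (x * y - x' * y').
  move=> Gx Gy; have -> : x * y - x' * y' = x * (y - y') + y' * (x - x') by ring.
  by apply: GD; apply: GM.
rewrite {1}[f]mpolyE comp_mpolyEX.
apply: (big_ind2 (fun x y => G (x - y))) => [|x x' y y' Gx Gy|m _]; first by rewrite subrr.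
  by rewrite opprD addrACA; apply: GD.
rewrite -scalerBr -mul_mpolyC; apply: GM; rewrite comp_mpolyX mpolyXE_id.
apply: (big_ind2 (fun x y => G (x - y))) => [|x x' y y'|i _]; rewrite ?subrr //; first exact: congM.
by elim: (m i) => [|e IH]; [rewrite subrr | rewrite !exprS; apply: congM].
Qed.

End MonomialNonzerodivisors.

(** * The example *)

Section Example.
Variables (k : fieldType) (r' : nat).
Local Notation r := r'.+1.
Local Notation s := r.+1.
Local Notation T := ('I_s * option 'I_r)%type.
Local Notation n := #|{: T}|.
Local Notation P := {mpoly k[n]}.
Implicit Types (m : 'X_{1..n}) (l : 'I_s) (c : 'I_r) (p q : T) (f : P).

(* [(l, None)] is the variable [y_l] and the [(l, Some c)] form the set [X_l]. *)
Definition idx p : 'I_n := enum_rank p.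
Definition mnm_of (F : T -> nat) : 'X_{1..n} := [multinom F (enum_val i) | i < n].

Lemma mnm_ofE F p : mnm_of F (idx p) = F p.
Proof. by rewrite mnmE enum_rankK. Qed.

Lemma idx_ex (i : 'I_n) : exists p, i = idx p.
Proof. by exists (enum_val i); rewrite /idx enum_valK. Qed.

Lemma idx_eq p q : (idx p == idx q) = (p == q).
Proof. exact: (inj_eq enum_rank_inj). Qed.

Lemma mnm_idxP m m' : (forall p, m (idx p) = m' (idx p)) -> m = m'.
Proof. by move=> E; apply/mnmP => i; have [p ->] := idx_ex i. Qed.

(** * Exponents within the blocks *)

Definition yv l m := m (idx (l, None)).
Definition xv l c m := m (idx (l, Some c)).
Definition xs l m := (\sum_c xv l c m)%N.
(** The exponent of the largest power of u_l dividing the monomial; the sum [mu] is the least weight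
    over all transversals. *)
Definition mn l m := xv l [arg min_(c < ord0) xv l c m] m.
Definition mu m := (\sum_l mn l m)%N.

Lemma mn_geP l m d : reflect (forall c, d <= xv l c m)%N (d <= mn l m)%N.
Proof.
rewrite /mn; case: arg_minnP => // c _ min_c.
by apply: (iffP idP) => [le_d c'|]; [apply: leq_trans le_d (min_c _ _) | apply].
Qed.

Lemma mn_le_xv l c m : (mn l m <= xv l c m)%N.
Proof. by have /mn_geP := leqnn (mn l m). Qed.

Lemma mn_le_xs l m : (r * mn l m <= xs l m)%N.
Proof.
rewrite -[r in leqLHS]card_ord -sum_nat_const.
by apply: leq_sum => c _; apply: mn_le_xv.
Qed.

Lemma eq_mn l m m' : (forall c, xv l c m = xv l c m') -> mn l m = mn l m'.
Proof.
move=> E; apply/eqP; rewrite eqn_leq.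
by apply/andP; split; apply/mn_geP => c; [rewrite -E | rewrite E]; apply: mn_le_xv.
Qed.

Lemma eq_xs l m m' : (forall c, xv l c m = xv l c m') -> xs l m = xs l m'.
Proof. by move=> E; apply: eq_bigr. Qed.

Lemma xvD l c m m' : xv l c (m + m')%MM = (xv l c m + xv l c m')%N.
Proof. exact: mnmDE. Qed.

Lemma xsD l m m' : xs l (m + m')%MM = (xs l m + xs l m')%N.
Proof. by rewrite -big_split; apply: eq_bigr => c _; apply: xvD. Qed.

Lemma yvD l m m' : yv l (m + m')%MM = (yv l m + yv l m')%N.
Proof. exact: mnmDE. Qed.

Lemma mnD_ge l m m' : (mn l m <= mn l (m + m')%MM)%N.
Proof. by apply/mn_geP => c; rewrite xvD (leq_trans (mn_le_xv _ c _)) ?leq_addr. Qed.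

(** * The minimal primes of the example *)

Definition block l : {set 'I_n} := idx (l, None) |: [set idx (l, Some c) | c : 'I_r].
Definition transversal (phi : {ffun 'I_s -> 'I_r}) : {set 'I_n} :=
  [set idx (l, Some (phi l)) | l : 'I_s].
Definition min_primes : {set {set 'I_n}} :=
  [set block l | l : 'I_s] :|: [set transversal phi | phi : {ffun 'I_s -> 'I_r}].

Lemma wt_block l m : wt (block l) m = (xs l m + yv l m)%N.
Proof.
rewrite /wt big_setU1 /=; last by apply/imsetP => -[c _ /eqP]; rewrite idx_eq => /eqP[].
rewrite addnC; congr (_ + _)%N; apply: big_imset => c c' _ _ /eqP.
by rewrite idx_eq => /eqP[].
Qed.

Lemma wt_transversal phi m : wt (transversal phi) m = (\sum_l xv l (phi l) m)%N.
Proof.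
by apply: big_imset => l l' _ _ /eqP; rewrite idx_eq => /eqP[].
Qed.

Lemma mem_block l p : (idx p \in block l) = (p.1 == l).
Proof.
rewrite in_setU1 idx_eq; case: p => l' [c|] /=; rewrite xpair_eqE /= ?andbF ?andbT /=.
  apply/imsetP/eqP => [[c' _ /eqP]|->]; last by exists c.
  by rewrite idx_eq => /eqP[].
case: (l' == l) => //=; by apply/imsetP => -[c _ /eqP]; rewrite idx_eq => /eqP[].
Qed.

Lemma mem_transversal phi p : (idx p \in transversal phi) = (p.2 == Some (phi p.1)).
Proof.
apply/imsetP/eqP => [[l _ /eqP]|]; first by rewrite idx_eq => /eqP->.
by case: p => l o /= ->; exists l.
Qed.

(** A block contains a y, which no transversal does, and a transversal meets all blocks, of which
    there are at least two. *)
Lemma min_primes_antichain F F' : F \in min_primes -> F' \in min_primes -> F \subset F' -> F = F'.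
Proof.
case/setUP => /imsetP[x _ ->] /setUP[] /imsetP[x' _ ->] /subsetP sFF'.
- have := sFF' (idx (x, None)); rewrite !mem_block /= eqxx => /(_ isT)/eqP->//.
- by have := sFF' (idx (x, None)); rewrite mem_block mem_transversal eqxx => /(_ isT).
- have F'x l : l = x'.
    by apply/eqP; have := sFF' (idx (l, Some (x l))); rewrite mem_block mem_transversal eqxx => ->.
  by have := F'x ord0; rewrite -(F'x ord_max).
- congr transversal; apply/ffunP => l; have := sFF' (idx (l, Some (x l))).
  by rewrite !mem_transversal eqxx => /(_ isT)/eqP[].
Qed.

(* Membership in [L t j] is membership in [sympow I t] after the substitution
   [y_l := y_0] for [l <= j]. *)
Definition L t (j : nat) : pred 'X_{1..n} := fun m =>
  [&& (t <= mu m)%N,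
      (\sum_(l < s | (l <= j)%N) (t - xs l m) <= \sum_(l < s | (l <= j)%N) yv l m)%N
    & [forall l : 'I_s, (j < l)%N ==> (t - xs l m <= yv l m)%N]].

Lemma sum_le0 (F : 'I_s -> nat) : (\sum_(l < s | (l <= 0)%N) F l = F ord0)%N.
Proof. by rewrite (big_pred1 ord0) // => l; rewrite leqn0. Qed.

Lemma L_upclosed t j : upclosed (L t j).
Proof.
move=> m m' /and3P[mu_m sum_m /forall_inP yv_m]; apply/and3P; split.
- by apply: leq_trans mu_m _; apply: leq_sum => l _; apply: mnD_ge.
- apply: (@leq_trans (\sum_(l < s | (l <= j)%N) (t - xs l m))%N).
    by apply: leq_sum => l _; rewrite xsD leq_sub2l ?leq_addr.
  by apply: leq_trans sum_m _; apply: leq_sum => l _; rewrite yvD leq_addr.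
- apply/forall_inP => l /yv_m le_l; rewrite xsD yvD.
  by apply: leq_trans (leq_trans le_l (leq_addr _ _)); rewrite leq_sub2l ?leq_addr.
Qed.

(** The transversal choosing a least exponent in each block has weight [mu m], so the transversal
    conditions reduce to one. For [j = 0] the sum condition concerns block 0 alone. *)
Lemma L0E t m : L t 0 m = [forall F in min_primes, (t <= wt F m)%N].
Proof.
apply/and3P/forall_inP => [[mu_m sum_m /forall_inP yv_m] F | wtF].
  case/setUP => /imsetP[x _ ->].
    rewrite wt_block -leq_subLR; have [x_gt0 | ] := ltnP 0 x; first exact: yv_m.
    rewrite leqn0 => /eqP x0; have -> : x = ord0 by apply: val_inj.
    by move: sum_m; rewrite !sum_le0.
  rewrite wt_transversal; apply: leq_trans mu_m _.
  by apply: leq_sum => l _; apply: mn_le_xv.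
have wtB l : (t - xs l m <= yv l m)%N.
  by rewrite leq_subLR -wt_block; apply: wtF; rewrite inE imset_f.
split; [|by rewrite !sum_le0|by apply/forall_inP].
pose phi := [ffun l => [arg min_(c < ord0) xv l c m]].
have := wtF (transversal phi); rewrite inE imset_f ?orbT // wt_transversal.
move=> /(_ isT)/leq_trans; apply.
by apply: leq_sum => l _; rewrite ffunE.
Qed.

Lemma sympowE t : sympow (@monomial_ideal k n (hitting_gens min_primes)) t = monI (k := k) (L t 0).
Proof.
rewrite (sympow_hitting k min_primes_antichain); congr monI.
by apply: functional_extensionality => m; rewrite L0E.
Qed.

(** * The differences of the y's and the substitution they induce *)

Definition y0 : 'I_n := idx (ord0, None).
Definition gdiff j : P := 'X_y0 - 'X_(idx (inord j.+1, None)).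
Definition gs d : seq P := mkseq gdiff d.

Definition merge j (p : T) : T :=
  if p is (l, None) then if (l <= j)%N then (ord0, None) else p else p.

Definition merge_tuple j : n.-tuple P := [tuple 'X_(idx (merge j (enum_val i))) | i < n].

(** The effect of substituting [merge_tuple j] on exponents, as [comp_mergeX] confirms. *)
Definition mergem j m : 'X_{1..n} := mnm_of (fun p =>
  if p is (l, None) then
    if (l <= j)%N then if l == ord0 then \sum_(l' < s | (l' <= j)%N) yv l' m else 0
    else yv l m
  else m (idx p))%N.

Lemma xv_merge j l c m : xv l c (mergem j m) = xv l c m.
Proof. by rewrite /xv mnm_ofE. Qed.

Lemma yv_merge j l m : yv l (mergem j m) =
  (if (l <= j)%N then if l == ord0 then \sum_(l' < s | (l' <= j)%N) yv l' m else 0 else yv l m)%N.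
Proof. by rewrite /yv mnm_ofE. Qed.

Lemma mergemD j m m' : mergem j (m + m')%MM = (mergem j m + mergem j m')%MM.
Proof.
apply: mnm_idxP => -[l [c|]]; rewrite mnmDE !mnm_ofE ?mnmDE //.
case: ifP => [_|_]; last exact: yvD.
case: ifP => // _; rewrite -[RHS]big_split /=.
by apply: eq_bigr => l' _; exact: yvD.
Qed.

Lemma U_idxE p q : U_(idx p)%MM (idx q) = (p == q).
Proof. by rewrite mnm1E idx_eq. Qed.

Lemma mergemU j p : mergem j U_(idx p)%MM = U_(idx (merge j p))%MM.
Proof.
apply: mnm_idxP => -[l [c|]]; rewrite mnm_ofE U_idxE.
  rewrite U_idxE; case: p => l' [c'|] //=.
  by case: ifP => _; rewrite !xpair_eqE !andbF.
have E l' : yv l' U_(idx p)%MM = (p == (l', None)) by rewrite /yv U_idxE.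
rewrite E; under eq_bigr do rewrite E.
case: p {E} => l' [c|] /=.
  by rewrite !xpair_eqE !andbF big1 ?if_same // => i _; rewrite xpair_eqE andbF.
under eq_bigr do rewrite xpair_eqE andbT.
have [le_l' | lt_l'] := leqP l' j; rewrite !xpair_eqE !andbT.
  have -> : (\sum_(i < s | (i <= j)%N) (l' == i) = 1)%N.
    by rewrite (bigD1 l') //= eqxx big1 // => i /andP[_ ni]; rewrite eq_sym (negPf ni).
  have [le_l | lt_l] := leqP l j; first by rewrite [ord0 == l]eq_sym; case: eqP.
  case: eqP => [El|_]; first by rewrite El leqNgt lt_l in le_l'.
  by case: eqP => // El; rewrite -El in lt_l.
rewrite big1 ?if_same => [|i le_i].
  by case: ifP => // le_l; case: eqP => // El; rewrite El ltnNge le_l in lt_l'.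
by case: eqP => // Ei; rewrite Ei ltnNge le_i in lt_l'.
Qed.

Lemma mergem_sum j (I : finType) (F : I -> 'X_{1..n}) :
  mergem j (\sum_i F i)%MM = (\sum_i mergem j (F i))%MM.
Proof.
apply: (big_morph (mergem j) (mergemD j)); apply: mnm_idxP => -[l [c|]]; rewrite mnm_ofE mnm0E //.
by rewrite /yv mnm0E big1 ?if_same // => l' _; rewrite mnm0E.
Qed.

Lemma mergemMn j m d : mergem j (m *+ d)%MM = (mergem j m *+ d)%MM.
Proof.
elim: d => [|d IH]; last by rewrite !mulmS mergemD IH.
by rewrite !mulm0n; have := mergem_sum j (fun x : void => 0%MM); rewrite !big_pred0.
Qed.

Lemma comp_mergeX j m : 'X_[m] \mPo merge_tuple j = 'X_[mergem j m] :> P.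
Proof.
rewrite comp_mpolyX [m in RHS]multinomUE_id mergem_sum.
rewrite (eq_bigr _ (fun i _ => mergemMn j U_(i) (m i))) -mprodXnE.
apply: eq_bigr => i _; rewrite tnth_mktuple.
by have [p ->] := idx_ex i; rewrite mergemU {1}/idx enum_rankK.
Qed.

Lemma sum_yv_merge j m :
  (\sum_(l < s | (l <= j)%N) yv l (mergem j m) = \sum_(l < s | (l <= j)%N) yv l m)%N.
Proof.
rewrite (bigD1 ord0) //= [X in (_ + X)%N]big1 => [|l /andP[le_l /negPf l0]].
  by rewrite yv_merge /= addn0.
by rewrite yv_merge le_l l0.
Qed.

Lemma L_merge t j m : L t j (mergem j m) = L t j m.
Proof.
have Exs l : xs l (mergem j m) = xs l m by apply: eq_xs => c; rewrite xv_merge.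
rewrite /L sum_yv_merge; congr [&& _, _ & _].
- by congr (_ <= _)%N; apply: eq_bigr => l _; apply: eq_mn => c; rewrite xv_merge.
- by congr (_ <= _)%N; apply: eq_bigr => l _; rewrite Exs.
- apply: eq_forallb => l; rewrite Exs yv_merge; case: ltnP => //= lt_l.
Qed.

Lemma L_ideal t j : ideal_pred (monI (k := k) (L t j)).
Proof. by apply: monI_ideal; apply: L_upclosed. Qed.

(** The merged y-exponents are redistributed: y_l with [0 < l <= j] gets exactly what block [l]
    lacks, and y_0 the rest, which covers block 0 by the sum condition. *)
Lemma L_cofinal t j m : L t j m -> exists2 m', L t 0 m' & mergem j m' = mergem j m.
Proof.
case/and3P => mu_m sum_m /forall_inP yv_m.
pose m' := mnm_of (fun p => if p is (l, None) then
    if (l <= j)%N then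
      if l == ord0 then (\sum_(l' < s | (l' <= j)%N) yv l' m) -
        \sum_(l' < s | (l' <= j)%N && (l' != ord0)) (t - xs l' m) else t - xs l m
    else yv l m
  else m (idx p))%N.
have Exv l c : xv l c m' = xv l c m by rewrite /xv mnm_ofE.
have Exs l : xs l m' = xs l m by apply: eq_xs.
have Eyv l : yv l m' = (if (l <= j)%N then
      if l == ord0 then (\sum_(l' < s | (l' <= j)%N) yv l' m) -
        \sum_(l' < s | (l' <= j)%N && (l' != ord0)) (t - xs l' m) else t - xs l m
    else yv l m)%N by rewrite /yv mnm_ofE.
have sumD1 : (t - xs ord0 m + \sum_(l' < s | (l' <= j)%N && (l' != ord0)) (t - xs l' m)
    <= \sum_(l' < s | (l' <= j)%N) yv l' m)%N.
  by rewrite (bigD1 ord0) //= in sum_m.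
exists m'.
  apply/and3P; split.
  - apply: (leq_trans mu_m); apply: leq_sum => l _; apply/mn_geP => c.
    by rewrite Exv mn_le_xv.
  - rewrite !sum_le0 Exs Eyv /= leq_subRL; last exact: leq_trans (leq_addl _ _) sumD1.
    by rewrite addnC.
  - apply/forall_inP => l l_gt0; rewrite Exs Eyv -val_eqE /=.
    by case: (leqP l j) => [_|/yv_m //]; rewrite -[_ == _]negbK -lt0n l_gt0.
apply: mnm_idxP => -[l [c|]]; rewrite !mnm_ofE //.
case: (leqP l j) => [le_l|lt_l]; last by rewrite Eyv leqNgt lt_l.
case: (l =P ord0) => // _.
rewrite (bigD1 ord0) //= Eyv /=.
rewrite [X in (_ + X)%N](eq_bigr (fun l' : 'I_s => (t - xs l' m)%N)).
  by rewrite subnK //; exact: leq_trans (leq_addl _ _) sumD1.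
by move=> l' /andP[le_l' /negPf l'0]; rewrite Eyv le_l' l'0.
Qed.

(** The substitution kills the differences and carries [L t 0] into [L t j]. Conversely [f] is
    congruent to its image, and by [L_cofinal] each monomial of [L t j] is congruent to one of
    [L t 0]. *)
Lemma adjoins_gsP t j f : (j <= r)%N ->
  adjoins (monI (L t 0)) (gs j) f <-> monI (L t j) (f \mPo merge_tuple j).
Proof.
move=> le_j; set J := adjoins _ _.
have idL := L_ideal t 0; have idJ : ideal_pred J by apply: adjoins_ideal.
have [J0 JD JM] := idJ.
split.
  have [_ LD LM] := L_ideal t j.
  apply: (adjoins_min (A := fun f => monI (L t j) (f \mPo merge_tuple j))).
  - split; first by rewrite comp_mpoly0; case: (L_ideal t j).
    + by move=> a b; rewrite comp_mpolyD; apply: LD.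
    + by move=> a b; rewrite rmorphM; apply: LM.
  - apply: monI_min; last first.
      move=> m Lm; rewrite comp_mergeX; apply/monIX; rewrite L_merge.
      case/and3P: Lm => mu_m; rewrite !sum_le0 => y0_m /forall_inP yv_m.
      have yv_m' l : (t - xs l m <= yv l m)%N.
        have [->//|] := eqVneq l ord0; rewrite -val_eqE -lt0n; exact: yv_m.
      apply/and3P; split=> //; last by apply/forall_inP.
      by apply: leq_sum.
    split; first by rewrite comp_mpoly0; case: (L_ideal t j).
    + by move=> a b; rewrite comp_mpolyD; apply: LD.
    + by move=> a b; rewrite rmorphM; apply: LM.
  - move=> g /mapP[d]; rewrite mem_iota => /andP[_ lt_d] ->.
    rewrite comp_mpolyB !comp_mergeX !mergemU /= inordK ?(leq_ltn_trans lt_d) // lt_d.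
    by rewrite subrr; case: (L_ideal t j).
have Jsub g : J (g - (g \mPo merge_tuple j)).
  apply: comp_mpoly_congr => // i; rewrite tnth_mktuple; have [[l o] ->] := idx_ex i.
  rewrite {2}/idx enum_rankK /merge; case: o => [c|]; first by rewrite subrr.
  case: ifP => le_l; last by rewrite subrr.
  have [l0|l_gt0] := posnP l; first by rewrite (_ : l = ord0) ?subrr //; apply: val_inj.
  (* Up to sign, y_l - y_0 is entry [l.-1] of [gs j]. *)
  rewrite -opprB; apply: (ideal_predN idJ); apply: mem_adjoins => //.
  apply/mapP; exists l.-1; first by rewrite mem_iota /= prednK.
  by rewrite /gdiff prednK // inord_val.
move=> Lf; rewrite -(subrK (f \mPo merge_tuple j) f); apply: (JD) => //.
move: Lf; apply: monI_min => // m /L_cofinal[m' Lm' Em].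
have JX a : J ('X_[mergem j a]) <-> J 'X_[a].
  rewrite -comp_mergeX; split=> Ja; last first.
    by rewrite -[_ \mPo _](subKr 'X_[a]); apply: ideal_predB.
  by rewrite -['X_[a]](subrK ('X_[a] \mPo merge_tuple j)); apply: JD.
by apply/JX; rewrite -Em; apply/JX; apply: sub_adjoins; apply/monIX.
Qed.

(** A failing [mu] condition involves no y. A failing sum condition involves y_0 but not y_(j+1),
    and a failing condition on a block [l > j] does not involve y_0; each persists as long as the
    exponent it does involve does not grow. *)
Lemma gdiff_nonzerodiv t j : (j < r)%N -> nonzerodiv (monI (L t j)) (gdiff j).
Proof.
move=> lt_j; have Ej : nat_of_ord (inord j.+1 : 'I_s) = j.+1 by rewrite inordK.
apply: nonzerodiv_diff => [|m badm].
  by rewrite idx_eq xpair_eqE andbT -val_eqE /= Ej.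
set p := y0; set q := idx _; pose agree m' := forall i, i != p -> i != q -> m' i = m i.
have agr_xv m' : agree m' -> forall l c, xv l c m' = xv l c m.
  by move=> agr l c; apply: agr; rewrite idx_eq xpair_eqE andbF.
have agr_yv m' : agree m' -> forall l, l != ord0 -> l != inord j.+1 -> yv l m' = yv l m.
  by move=> agr l l0 lj; apply: agr; rewrite idx_eq xpair_eqE andbT.
have agr_xs m' : agree m' -> forall l, xs l m' = xs l m.
  by move=> agr l; apply: eq_xs => c; apply: agr_xv.
have agr_mu m' : agree m' -> mu m' = mu m.
  by move=> agr; apply: eq_bigr => l _; apply: eq_mn => c; apply: agr_xv.
rewrite /L !negb_and in badm.
have [mu_m | badmu] := boolP (t <= mu m)%N; last first.
  by left=> m' agr _; rewrite /L agr_mu // (negPf badmu).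
have [sum_m | badsum] := boolP (\sum_(l < s | (l <= j)%N) (t - xs l m)
    <= \sum_(l < s | (l <= j)%N) yv l m)%N; last first.
  left=> m' agr le_p; rewrite /L (eq_bigr (fun l => (t - xs l m)%N)); last first.
    by move=> l _; rewrite agr_xs.
  rewrite !negb_and orbA orbAC; apply/orP; right; rewrite -ltnNge.
  move: badsum; rewrite -ltnNge; apply: leq_ltn_trans.
  apply: leq_sum => l le_l; have [->|l0] := eqVneq l ord0; first exact: le_p.
  by rewrite agr_yv // -val_eqE /= Ej; apply: contraTneq le_l => ->; rewrite ltnn.
rewrite mu_m sum_m /= negb_forall_in in badm; case/exists_inP: badm => l lt_l bad_l.
right=> m' agr le_q; rewrite /L !negb_and; apply/orP; right; apply/orP; right.
rewrite negb_forall_in; apply/exists_inP; exists l => //; rewrite agr_xs //.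
apply: contra bad_l => /leq_trans; apply.
have [->|lj] := eqVneq l (inord j.+1); first exact: le_q.
by rewrite agr_yv // -val_eqE -lt0n (leq_ltn_trans _ lt_l).
Qed.

(** * The last regular element *)

Definition block_mon l : 'X_{1..n} :=
  mnm_of (fun p => if p is (l', Some _) then nat_of_bool (l' == l) else 0%N).

Definition last_mon (o : option 'I_s) : 'X_{1..n} := if o is Some l then block_mon l else U_(y0)%MM.

Definition last_elt : P := \sum_o 'X_[last_mon o].

Lemma xv_um l c l' : xv l c (block_mon l') = (l == l').
Proof. by rewrite /xv mnm_ofE. Qed.

Lemma yv_um l l' : yv l (block_mon l') = 0%N.
Proof. by rewrite /yv mnm_ofE. Qed.

Lemma xv_y0 l c : xv l c U_(y0)%MM = 0%N.
Proof. by rewrite /xv U_idxE xpair_eqE andbF. Qed.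

Lemma yv_y0 l : yv l U_(y0)%MM = (l == ord0).
Proof. by rewrite /yv U_idxE xpair_eqE andbT eq_sym. Qed.

Lemma xs_um l l' : xs l (block_mon l') = if l == l' then r else 0%N.
Proof.
rewrite /xs; under eq_bigr do rewrite xv_um.
by rewrite sum_nat_const card_ord; case: (l == l'); rewrite ?muln1 ?muln0.
Qed.

Lemma mnD_um l l' m : mn l (m + block_mon l')%MM = (mn l m + (l == l'))%N.
Proof.
apply/eqP; rewrite eqn_leq; apply/andP; split; last first.
  by apply/mn_geP => c; rewrite xvD xv_um leq_add2r mn_le_xv.
have : (mn l (m + block_mon l')%MM - (l == l') <= mn l m)%N.
  apply/mn_geP => c; rewrite leq_subLR addnC -(xv_um l c l') -xvD.
  exact: mn_le_xv.
by rewrite leq_subLR addnC.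
Qed.

Lemma muD_um l m : mu (m + block_mon l)%MM = (mu m).+1.
Proof.
rewrite /mu; under eq_bigr do rewrite mnD_um.
rewrite big_split /= -[RHS]addn1; congr (_ + _)%N.
by rewrite (bigD1 l) //= eqxx big1 // => i /negPf->.
Qed.

Lemma muD_y0 m : mu (m + U_(y0))%MM = mu m.
Proof.
apply: eq_bigr => l _; apply: eq_mn => c.
by rewrite xvD xv_y0 addn0.
Qed.

Definition deficit t m := (\sum_l (t - xs l m))%N.
Definition ytot m := (\sum_l yv l m)%N.

Lemma LrE t m : L t r m = (t <= mu m)%N && (deficit t m <= ytot m)%N.
Proof.
have le_r l : (l <= r)%N by rewrite -ltnS.
have E (F : 'I_s -> nat) : (\sum_(l < s | (l <= r)%N) F l = \sum_l F l)%N.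
  by apply: eq_bigl => l; rewrite le_r.
rewrite /L !E; congr (_ && _); rewrite -[RHS]andbT; congr (_ && _).
by apply/forall_inP => l; rewrite ltnNge le_r.
Qed.

Lemma deficitD t m m' : (deficit t (m + m')%MM <= deficit t m)%N.
Proof. by apply: leq_sum => l _; rewrite xsD leq_sub2l ?leq_addr. Qed.

Lemma ytotD m m' : ytot (m + m')%MM = (ytot m + ytot m')%N.
Proof. by rewrite -big_split; apply: eq_bigr => l _; apply: yvD. Qed.

Lemma ytot_um l : ytot (block_mon l) = 0%N.
Proof. by rewrite /ytot big1 // => l' _; apply: yv_um. Qed.

Lemma ytot_y0 : ytot U_(y0)%MM = 1%N.
Proof.
rewrite /ytot (bigD1 ord0) //= yv_y0 eqxx big1 // => l /negPf l0.
by rewrite yv_y0 l0.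
Qed.

(** Put q = (t - 1) %/ r. If every block had degree below [t], all minimal exponents would be at
    most q, so t <= q s; as also q r < t, this puts [t] in E(s) with i = q. *)
Lemma full_block t m : (0 < t)%N -> ~ in_E s t -> (t <= mu m)%N ->
  exists l, (t <= xs l m)%N.
Proof.
move=> t_gt0 Et mu_m; apply/existsP; rewrite -[[exists _, _]]negbK negb_exists.
apply/negP => /forallP small; apply: Et; exists ((t - 1) %/ r)%N.
have mn_l l : (mn l m <= (t - 1) %/ r)%N.
  rewrite leq_divRL // mulnC (leq_trans (mn_le_xs l m)) //.
  by have := small l; rewrite -ltnNge; case: (t) t_gt0 => // t' _; rewrite ltnS subn1.
have le_t : (t <= (t - 1) %/ r * s)%N.
  apply: leq_trans mu_m _; rewrite mulnC -[s in leqRHS]card_ord -sum_nat_const.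
  exact: leq_sum.
have le_qr := leq_divM (t - 1) r; split.
  by rewrite lt0n; apply: contraTneq le_t => ->; rewrite mul0n -ltnNge.
by rewrite le_t andbT [(s - 1)%N]subn1 /= addn1 -[X in (_ < X)%N](subnK t_gt0) addn1 ltnS.
Qed.

(* The extremal monomial [m] is chosen so that the term [m * u_l], for a block [l]
   already of degree at least [t], cannot be cancelled in the product. *)
Lemma last_elt_nonzerodiv t : (0 < t)%N -> ~ in_E s t ->
  nonzerodiv (monI (k := k) (L t r)) last_elt.
Proof.
move=> t_gt0 Et f Lhf m0 f_m0; apply: contraT => badm0.
(* If some monomial has [mu] below [t], one with least [mu] is multiplied by y_0: a cancelling term
   would be u_l times a monomial of smaller [mu]. *)
have [/hasP[m1 f_m1 mu_m1] | /hasPn mu_f] := boolP (has (fun m => mu m < t)%N (msupp f)).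
  have [m [f_m mu_m min_m]] := seq_argmin (p := fun m => (mu m < t)%N) mu f_m1 mu_m1.
  have := Lhf (m + last_mon None)%MM; rewrite LrE /= muD_y0 leqNgt mu_m; apply.
  apply: (@mem_msupp_sumM _ _ _ last_mon f m None) => // -[l|//] m' f_m' Em.
  have : mu m = (mu m').+1 by rewrite -(muD_um l) Em muD_y0.
  move=> Emu; have mu_m' : (mu m' < t)%N by rewrite ltnW // -Emu.
  by have := min_m m' f_m' mu_m'; rewrite Emu ltnn.
pose bad m := (ytot m < deficit t m)%N.
have fL m : m \in msupp f -> L t r m = ~~ bad m.
  by move=> /mu_f mu_m; rewrite LrE leqNgt mu_m /bad -leqNgt.
rewrite fL // negbK in badm0.
(* Successive choices among the bad monomials: largest deficit, then least y-degree, then largest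
   degree in a single block. *)
have [m1 [f_m1 bad_m1 max_m1]] := seq_argmax (deficit t) f_m0 badm0.
pose p2 m := bad m && (deficit t m == deficit t m1).
have p2_m1 : p2 m1 by rewrite /p2 bad_m1 eqxx.
have [m2 [f_m2 p2_m2 min_m2]] := seq_argmin ytot f_m1 p2_m1.
pose p3 m := p2 m && (ytot m == ytot m2).
have p3_m2 : p3 m2 by rewrite /p3 p2_m2 eqxx.
pose top m := (\max_l xs l m)%N.
have [m [f_m /andP[/andP[bad_m /eqP Cm] /eqP Ym] max_m]] := seq_argmax top f_m2 p3_m2.
have mu_m : (t <= mu m)%N by rewrite leqNgt mu_f.
have [l1 le_l1] := full_block t_gt0 Et mu_m.
have [l0 top_m] : {l0 | top m = xs l0 m} by apply: eq_bigmax; rewrite card_ord.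
have le_l0 : (t <= xs l0 m)%N by rewrite -top_m (leq_trans le_l1) // (leq_bigmax l1).
(* Block [l0] lacks nothing, so its monomial changes neither deficit nor y-degree, and the product
   stays bad. *)
have CM : deficit t (m + block_mon l0)%MM = deficit t m.
  apply: eq_bigr => l _; rewrite xsD xs_um; case: eqP => [->|_]; last by rewrite addn0.
  by move: le_l0; rewrite -!subn_eq0 subnDA => /eqP->.
have YM : ytot (m + block_mon l0)%MM = ytot m by rewrite ytotD ytot_um addn0.
have := Lhf (m + last_mon (Some l0))%MM; rewrite LrE /= CM YM.
rewrite [(deficit _ _ <= _)%N]leqNgt (bad_m : (ytot m < deficit t m)%N) andbF => contra; apply: contra.
apply: (@mem_msupp_sumM _ _ _ last_mon f m (Some l0)) => // o m' f_m' Em.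
(* A competitor [m'] divides the same product, so its deficit is at least that of [m]. With no
   larger y-degree it is bad too, and maximality makes the deficits equal. *)
have p2_m' : (ytot m' <= ytot m)%N -> p2 m'.
  move=> le_Y; have le_C : (deficit t m <= deficit t m')%N by rewrite -CM -Em deficitD.
  have bad_m' : bad m' by apply: leq_ltn_trans le_Y (leq_trans bad_m le_C).
  by rewrite /p2 bad_m' eqn_leq max_m1 // -Cm.
case: o Em => [l|] Em; last first.
  have Y' : ytot m = (ytot m').+1 by rewrite -YM -Em ytotD ytot_y0 addn1.
  by have := min_m2 m' f_m'; rewrite -Ym Y' ltnn => /(_ (p2_m' _)); rewrite Y' leqnSn => /(_ isT).
congr Some; apply/eqP; apply: contraT => ne_l.
have Y' : ytot m' = ytot m by rewrite -YM -Em ytotD ytot_um addn0.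
have := max_m m' f_m'; rewrite /p3 p2_m' ?Y' ?Ym ?eqxx // => /(_ isT).
(* A competitor from another block has [r] more than [m] in block [l0], above the maximum. *)
have := congr1 (xs l0) Em; rewrite !xsD !xs_um eqxx eq_sym (negPf ne_l) addn0 => X'.
by rewrite top_m => /(leq_trans (leq_bigmax l0)); rewrite X' -[leqRHS]addn0 leq_add2l.
Qed.

(** * Regular sequences on the symbolic powers *)

Lemma gdiff_nonzerodiv_adjoins t j : (j < r)%N ->
  nonzerodiv (adjoins (monI (L t 0)) (gs j)) (gdiff j).
Proof.
move=> lt_j f /(adjoins_gsP _ _ (ltnW lt_j)); rewrite rmorphM /=.
have -> : gdiff j \mPo merge_tuple j = gdiff j.
  by rewrite comp_mpolyB !comp_mergeX !mergemU /= inordK // ltnn.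
by move/(gdiff_nonzerodiv lt_j)/(adjoins_gsP _ _ (ltnW lt_j)).
Qed.

Lemma comp_last_elt j : last_elt \mPo merge_tuple j = last_elt.
Proof.
rewrite /last_elt rmorph_sum; apply: eq_bigr => o _; rewrite [LHS]comp_mergeX.
congr 'X_[_]; case: o => [l|] /=; last by rewrite mergemU.
apply: mnm_idxP => -[l' [c|]]; rewrite mnm_ofE //.
by rewrite [RHS](yv_um l' l) yv_um big1 ?if_same // => i _; apply: yv_um.
Qed.

Lemma last_elt_nonzerodiv_adjoins t : (0 < t)%N -> ~ in_E s t ->
  nonzerodiv (adjoins (monI (L t 0)) (gs r)) last_elt.
Proof.
move=> t_gt0 Et f /(adjoins_gsP _ _ (leqnn r)); rewrite rmorphM /= comp_last_elt.
by move/(last_elt_nonzerodiv t_gt0 Et)/(adjoins_gsP _ _ (leqnn r)).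
Qed.

Lemma take_gs d j : (j <= d)%N -> take j (gs d) = gs j.
Proof. by move=> le_j; rewrite /gs /mkseq -map_take take_iota (minn_idPl le_j). Qed.

Lemma size_gs d : size (gs d) = d.
Proof. exact: size_mkseq. Qed.

Lemma rseq_gs t : rseq (monI (L t 0)) (gs r).
Proof.
apply/rseqP => j; rewrite size_gs => lt_j f.
by rewrite take_gs 1?ltnW // nth_mkseq //; apply: gdiff_nonzerodiv_adjoins.
Qed.

Lemma rseq_gs_last t : (0 < t)%N -> ~ in_E s t ->
  rseq (monI (L t 0)) (rcons (gs r) last_elt).
Proof.
move=> t_gt0 Et; apply/rseqP => j; rewrite size_rcons size_gs ltnS => le_j f.
rewrite -cats1 takel_cat ?size_gs // take_gs // nth_cat size_gs.
case: (ltnP j r) => [lt_j | ge_j].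
  by rewrite nth_mkseq //; apply: gdiff_nonzerodiv_adjoins.
have -> : j = r by apply/eqP; rewrite eqn_leq le_j ge_j.
by rewrite subnn; apply: last_elt_nonzerodiv_adjoins.
Qed.

Lemma max_homogX m (i : 'I_n) : m i != 0%N -> max_homog ('X_[m] : P).
Proof.
move=> mi; have [_ _ IM] := gen_ideal_ideal (fun g : P => exists i : 'I_n, g = 'X_i).
rewrite -(@submK n U_(i) m) ?lep1mP // mpolyXD; apply: IM.
by apply: mem_gen_ideal; exists i.
Qed.

Lemma max_homog_ideal : ideal_pred (@max_homog k n).
Proof. exact: gen_ideal_ideal. Qed.

Lemma max_homog_gdiff j : max_homog (gdiff j).
Proof.
by apply: (ideal_predB max_homog_ideal); apply: mem_gen_ideal; eexists.
Qed.

Lemma max_homog_last : max_homog last_elt.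
Proof.
apply: (ideal_pred_sum max_homog_ideal) => -[l|] _.
  by apply: (@max_homogX _ (idx (l, Some ord0))); rewrite mnm_ofE eqxx.
by apply: (@max_homogX _ y0); rewrite mnm1E eqxx.
Qed.

Lemma max_homog_gs d f : f \in gs d -> max_homog f.
Proof. by case/mapP => j _ ->; apply: max_homog_gdiff. Qed.

Lemma monI_L_irrelevant t f : (0 < t)%N -> monI (L t 0) f -> irrelevant f.
Proof.
move=> t_gt0 Lf; apply: memN_msupp_eq0; apply/negP => /Lf /and3P[+ _ _].
rewrite leqNgt /mu big1 ?t_gt0 // => l _; exact: mnm0E.
Qed.

(** * The socle element for t in E(s) *)

Definition socle_mon t i : 'X_{1..n} := mnm_of (fun p =>
  if p is (l, None) then if l == ord0 then (s * (t - r * i)).-1 else 0 else i)%N.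

Lemma xs_socle t i l : xs l (socle_mon t i) = (r * i)%N.
Proof.
rewrite /xs; under eq_bigr do rewrite /xv mnm_ofE.
by rewrite sum_nat_const card_ord.
Qed.

Lemma deficit_socle t i : deficit t (socle_mon t i) = (s * (t - r * i))%N.
Proof.
rewrite /deficit; under eq_bigr do rewrite xs_socle.
by rewrite sum_nat_const card_ord.
Qed.

Lemma ytot_socle t i : ytot (socle_mon t i) = (s * (t - r * i)).-1.
Proof.
rewrite /ytot (bigD1 ord0) //= {1}/yv mnm_ofE /= big1 ?addn0 // => l /negPf l0.
by rewrite /yv mnm_ofE l0.
Qed.

Lemma mu_socle t i : mu (socle_mon t i) = (s * i)%N.
Proof.
rewrite /mu (eq_bigr (fun=> i)) ?sum_nat_const ?card_ord // => l _.
by rewrite /mn /xv mnm_ofE.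
Qed.

Lemma socle_not_L t i : (r * i < t)%N -> ~~ L t r (socle_mon t i).
Proof.
move=> lt_t; rewrite LrE negb_and deficit_socle ytot_socle; apply/orP; right.
by rewrite -ltnNge prednK // muln_gt0 subn_gt0.
Qed.

(** The deficit of [socle_mon t i] exceeds its y-degree by one. An x lowers the deficit by one,
    since [r * i < t], and a y raises the y-degree by one. *)
Lemma socle_mul_L t i p : (r * i < t)%N -> (t <= s * i)%N ->
  L t r (U_(idx p) + socle_mon t i)%MM.
Proof.
move=> lt_t le_t; rewrite LrE addmC; apply/andP; split.
  apply: leq_trans le_t _; rewrite -(mu_socle t).
  by apply: leq_sum => l _; apply: mnD_ge.
have d_gt0 : (0 < s * (t - r * i))%N by rewrite muln_gt0 subn_gt0.
rewrite ytotD ytot_socle; case: p => l [c|].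
  have -> : ytot U_(idx (l, Some c))%MM = 0%N.
    by rewrite /ytot big1 // => l' _; rewrite /yv U_idxE xpair_eqE andbF.
  rewrite addn0 -ltnS prednK // -deficit_socle /deficit [X in (X < _)%N](bigD1 l) //=.
  rewrite [X in (_ < X)%N](bigD1 l) //= -addSn; apply: leq_add.
    rewrite xsD xs_socle; have -> : xs l U_(idx (l, Some c))%MM = 1%N.
      rewrite /xs (bigD1 c) //= {1}/xv U_idxE eqxx big1 // => c' /negPf nc.
      by rewrite /xv U_idxE xpair_eqE eqxx /= (inj_eq Some_inj) eq_sym nc.
    by rewrite addn1 subnS prednK // subn_gt0.
  by apply: leq_sum => l' _; rewrite xsD leq_sub2l ?leq_addr.
have -> : ytot U_(idx (l, None))%MM = 1%N.
  rewrite /ytot (bigD1 l) //= {1}/yv U_idxE eqxx big1 // => l' /negPf nl.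
  by rewrite /yv U_idxE xpair_eqE eq_sym nl.
by rewrite addn1 prednK // -deficit_socle; apply: deficitD.
Qed.

(** * Depths of the symbolic powers *)

Lemma has_regseq_gs t : (0 < t)%N -> has_regseq (monI (k := k) (L t 0)) r.
Proof.
move=> t_gt0; rewrite -[X in has_regseq _ X](size_gs r).
apply: (has_regseqP (L_ideal t 0)); [|exact: max_homog_gs|exact: rseq_gs].
by move=> f; apply: monI_L_irrelevant.
Qed.

Lemma depth_in_E t : (0 < t)%N -> in_E s t -> depth (monI (k := k) (L t 0)) = r.
Proof.
move=> t_gt0 [i [_ /andP[lt_t le_t]]]; rewrite [(s - 1)%N]subn1 addn1 mulnC /= in lt_t.
rewrite mulnC in le_t; have idL := L_ideal t 0.
have bound e : has_regseq (monI (k := k) (L t 0)) e -> (e <= r)%N.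
  rewrite -[X in (_ <= X)%N](size_gs r).
  apply: (has_regseq_le_socle (v := 'X_[socle_mon t i]) idL _ (rseq_gs t)) => [||j].
  - exact: max_homog_gs.
  - move/(adjoins_gsP _ _ (leqnn r)); rewrite comp_mergeX => /monIX.
    by rewrite L_merge; apply/negP/socle_not_L.
  - apply/adjoins_gsP => //; rewrite -mpolyXD comp_mergeX; apply/monIX.
    by rewrite L_merge; have [p ->] := idx_ex j; apply: socle_mul_L.
by apply/eqP; rewrite eqn_leq depth_leq ?(leq_depth (has_regseq_gs t_gt0) bound).
Qed.

Lemma depth_notin_E t : (0 < t)%N -> ~ in_E s t -> (r < depth (monI (k := k) (L t 0)))%N.
Proof.
move=> t_gt0 Et; have Lm f : monI (k := k) (L t 0) f -> irrelevant f by apply: monI_L_irrelevant.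
apply: leq_depth (fun e => has_regseq_le (L_ideal t 0) Lm).
have sz : size (rcons (gs r) last_elt) = r.+1 by rewrite size_rcons size_gs.
rewrite -[X in has_regseq _ X]sz.
apply: (has_regseqP (L_ideal t 0) Lm); last exact: rseq_gs_last.
by move=> f; rewrite mem_rcons inE => /predU1P[->|/max_homog_gs //]; apply: max_homog_last.
Qed.

End Example.

Theorem theorem2p8 (k : fieldType) (s : nat) (hs : (3 <= s)%N) :
  exists (n : nat) (g : seq 'X_{1..n}),
    (forall m, m \in g -> squarefree_mon m) /\
    forall t : nat, (0 < t)%N ->
      ((depth (sympow (@monomial_ideal k n g) s) <
          depth (sympow (@monomial_ideal k n g) t))%N
       <-> ~ in_E s t).
Proof.
case: s hs => [|[|r']] // _; exists _, (hitting_gens (min_primes r')).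
split=> [m|t t_gt0]; first exact: hitting_gens_squarefree.
(* The exponent s lies in E(s) with i = 1, so the depth on the left is s - 1. *)
have Es : in_E r'.+2 r'.+2 by exists 1%N; rewrite !mul1n subn1 addn1 /= !leqnn.
rewrite !sympowE (depth_in_E k (ltn0Sn _) Es); split=> [lt_d Et | Et]; last exact: depth_notin_E.
by rewrite (depth_in_E k t_gt0 Et) ltnn in lt_d.
Qed.
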